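(* Let $n\ge1$, let $\alpha=(k,1^{n-k})$ with $k\in[n]$ odd be an odd hook, and let $\sigma\in\mathfrak S_n$ be of cycle type $\alpha$. Then $\sigma\in\Sigma_\alpha$ if and only if $\sigma$ satisfies the hook properties.
   Context: $[a,b]=\{c\in\mathbb Z\mid a\le c\le b\}$ and $[a]=[1,a]$. $\mathfrak S_n$ is the symmetric group on $[n]$ (products are compositions of functions), with Coxeter generators $s_i=(i,i+1)$ and Coxeter length function $\ell$ (number of inversions). Relation $\approx$: write $w\overset{s_i}{\to}w'$ if $w'=s_iws_i$ and $\ell(w')\le\ell(w)$. Let $\to$ be the reflexive and transitive closure of the union of the relations $\overset{s_i}{\to}$, $1\le i\le n-1$. Write $w\approx w'$ if $w\to w'$ and $w'\to w$; this is an equivalence relation on $\mathfrak S_n$. Element in stair form: let $(x_1,\dots,x_n)$ be the list with $x_{2i-1}=i$ and $x_{2i}=n-i+1$. For a composition $\alpha=(\alpha_1,\dots,\alpha_l)$ of $n$, $\sigma_\alpha\in\mathfrak S_n$ is the product of the disjoint cycles $(x_{\alpha_1+\dots+\alpha_{i-1}+1},\dots,x_{\alpha_1+\dots+\alpha_{i-1}+\alpha_i})$, $i=1,\dots,l$. $\Sigma_\alpha$ denotes the $\approx$-equivalence class of $\sigma_\alpha$ (here used for the hook $\alpha=(k,1^{n-k})$). For a $k$-cycle: a $k$-cycle $\tau\in\mathfrak S_k$ is oscillating if there is a positive integer $m\in\{\frac{k-1}2,\frac k2,\frac{k+1}2\}$ with $\tau([m])=[k-m+1,k]$. A subset $M\subseteq[k]$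 is connected in $\tau$ if there is $m\in M$ with $M=\{m,\tau(m),\dots,\tau^{|M|-1}(m)\}$; the $k$-cycle $\tau\in\mathfrak S_k$ has connected intervals if $[j,k-j+1]$ is connected in $\tau$ for all integers $j$ with $1\le j\le\frac k2$. Cycle standardization: for a $k$-cycle $(c_1,\dots,c_k)$ in $\mathfrak S_n$, $\operatorname{cst}((c_1,\dots,c_k))\in\mathfrak S_k$ is the $k$-cycle $(r_1,\dots,r_k)$ with $r_i=|\{j\in[k]\mid c_j\le c_i\}|$. A permutation $\sigma\in\mathfrak S_n$, written as a product of disjoint cycles including the trivial ones, is oscillating (resp. has connected intervals) if the cycle standardization of each of its cycles is oscillating (resp. has connected intervals). Hook properties: let $\sigma\in\mathfrak S_n$ be of cycle type $(k,1^{n-k})$, and put $m=\frac{k-1}2$ if $k$ is odd and $m=\frac k2$ if $k$ is even. $\sigma$ satisfies the hook properties if (1) $\sigma$ is oscillating, (2) $\sigma$ has connected intervals, (3) if $k>1$ then $i$ and $n-i+1$ appear in the cycle of length $k$ of $\sigma$ for all $i\in[m]$. *)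

(* Defs.v *)
From mathcomp Require Import all_boot all_fingroup.

Set Implicit Arguments.
Unset Strict Implicit.
Unset Printing Implicit Defensive.

(* The set [n] = {1, ..., n} is represented by 'I_n: the ordinal of value i
   stands for the integer i.+1. The product of 'S_n is composition in the
   opposite order, which is immaterial below: it is only applied to conjugation
   by an involution and to products of disjoint cycles. *)

(* The integer interval [a, b] intersected with [n]; a and b are 1-based. *)
Definition itv n (a b : nat) : {set 'I_n} := [set i : 'I_n | a <= i.+1 <= b].

Definition coxeter_length n (w : 'S_n) : nat :=
  #|[set p : 'I_n * 'I_n | (p.1 < p.2) && (w p.2 < w p.1)]|.

(* The union over i of the relations w -> s_i w s_i with non-increasing length. *)
Definition conj_step n : rel 'S_n := fun w w' =>
  [exists i : 'I_n, exists j : 'I_n,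
    [&& j == i.+1 :> nat,
        w' == (tperm i j * w * tperm i j)%g &
        coxeter_length w' <= coxeter_length w]].

Definition conj_le n : rel 'S_n := connect (@conj_step n).

Definition conj_equiv n : rel 'S_n := fun w w' => conj_le w w' && conj_le w' w.

(* The cycle (c_1, ..., c_k), sending c_i to c_(i+1) and c_k to c_1; undup only
   serves to get a permutation for lists with repetitions. *)
Definition cycle_perm (T : finType) (c : seq T) : {perm T} :=
  perm (can_inj (prev_next (undup_uniq c))).

Fact half_ord_subproof n (p : 'I_n) : p./2 < n.
Proof.
by apply: leq_ltn_trans (ltn_ord p); rewrite leq_half_double -addnn leqW ?leq_addr.
Qed.

Definition half_ord n (p : 'I_n) : 'I_n := Ordinal (half_ord_subproof p).

(* The entry x_(p+1): the position p = 2i - 2 holds i and the position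
   p = 2i - 1 holds n - i + 1, the reversal of i. *)
Definition stair_entry n (p : 'I_n) : 'I_n :=
  if odd p then rev_ord (half_ord p) else half_ord p.

Definition stair_seq n : seq 'I_n := [seq stair_entry p | p <- enum 'I_n].

Definition stair_perm n (alpha : seq nat) : 'S_n :=
  (\prod_(c <- reshape alpha (stair_seq n)) cycle_perm c)%g.

Definition stair_class n (alpha : seq nat) : {set 'S_n} :=
  [set w | conj_equiv (stair_perm n alpha) w].

Definition hook n k : seq nat := k :: nseq (n - k) 1.

Definition has_cycle_type n (s : 'S_n) (alpha : seq nat) : bool :=
  perm_eq [seq #|C| | C : {set 'I_n} <- enum (porbits s)] alpha.

(* m ranges over the positive integers among (k - 1)/2, k/2 and (k + 1)/2. *)
Definition oscillating_cycle k (t : 'S_k) : Prop :=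
  exists m : nat,
    [/\ 0 < m, m.*2 \in [:: k.-1; k; k.+1]
      & t @: itv k 1 m = itv k (k - m + 1) k].

Definition connected_in k (t : 'S_k) (M : {set 'I_k}) : Prop :=
  exists2 m, m \in M & M = [set (t ^+ i)%g m | i : 'I_#|M|].

Definition connected_intervals_cycle k (t : 'S_k) : Prop :=
  forall j : nat, 0 < j -> j.*2 <= k -> connected_in t (itv k j (k - j + 1)).

Definition cst_rank n k (c : k.-tuple 'I_n) (i : 'I_k) : nat :=
  #|[set j : 'I_k | tnth c j <= tnth c i]|.

Fact cst_rank_subproof n k (c : k.-tuple 'I_n) (i : 'I_k) :
  (cst_rank c i).-1 < k.
Proof.
have k_gt0 : 0 < k := leq_ltn_trans (leq0n i) (ltn_ord i).
by rewrite (leq_ltn_trans _ (_ : k.-1 < k)) ?prednK // -!subn1 leq_sub2r //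
           -[leqRHS]card_ord max_card.
Qed.

(* The predecessor accounts for the 0-based representation of [k]. *)
Definition cst n k (c : k.-tuple 'I_n) : 'S_k :=
  cycle_perm [seq Ordinal (cst_rank_subproof c i) | i <- enum 'I_k].

(* fingraph.orbit s x lists x, s x, s (s x), ..., that is, the cycle of s through x. *)
Definition cst_at n (s : 'S_n) (x : 'I_n) : 'S_(size (fingraph.orbit s x)) :=
  cst (in_tuple (fingraph.orbit s x)).

Definition oscillating n (s : 'S_n) : Prop :=
  forall x : 'I_n, oscillating_cycle (cst_at s x).

Definition connected_intervals n (s : 'S_n) : Prop :=
  forall x : 'I_n, connected_intervals_cycle (cst_at s x).

(* For s of cycle type (k, 1, ..., 1) with k > 1 the orbit C below is unique.
   The bound k./2 is (k - 1)/2 for k odd and k/2 for k even. *)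
Definition hook_properties n k (s : 'S_n) : Prop :=
  [/\ oscillating s,
      connected_intervals s
    & 1 < k ->
      exists C : {set 'I_n},
        [/\ C \in porbits s, #|C| = k
          & forall i, i \in itv n 1 k./2 -> i \in C /\ rev_ord i \in C]].

(* Main.v *)
(** Write k = 2r+1, with labels 0, ..., n-1 and x* = n-1-x. The hook properties
say that the k-cycle moves the small labels i < r, the large labels i* and one
middle label c; that, up to inversion, it sends every small label to a large one;
and that its points in each window [a, a*] form an arc, that is, at most one of
them is mapped out of the window.

Conjugation by s_i preserves the length exactly when one of s, s^-1 is increasing
on (i, i+1) and the other one decreasing (or when it fixes s). Such a move keeps the
hook properties: only the window [i+1, (i+1)*] can be broken, and in every
configuration where it would be, both s and s^-1 are increasing, or both are
decreasing. The one parity fact needed is that a window has as many small as large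
labels, so its arc cannot be both entered from and left to large labels.

Conversely, c can be moved down to r. If i and i* are neighbours in the cycle for
some i > 0, taking i minimal, a swap of i-1, i or of (i-1)*, i* is
length-preserving and moves this pair of neighbours out to level i-1, where it is
harmless if i = 1. When no such pair is left, every level is attached on both sides
of the inner arc, which determines the cycle up to its direction, and swapping r-1
with c = r reverses the direction. So all elements with the hook properties, among
them the stair element, are equivalent. *)

Require Import Defs.
From mathcomp Require Import all_boot all_fingroup zify.

Set Implicit Arguments.
Unset Strict Implicit.
Unset Printing Implicit Defensive.

(** * Hook cycles as functions on the natural numbers *)

Definition window n a x := a <= x < n - a.

(* On a cycle this says that the points of the window form an arc. *)
Definition unique_exit n a (f : nat -> nat) := forall x y,
  window n a x -> window n a y -> ~~ window n a (f x) -> ~~ window n a (f y) ->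
  x = y.

(** For k = 2r+1 this is the oscillating condition with m = r; with [f] and [g] exchanged it is the
    condition with m = r+1. *)
Definition oriented n r (f g : nat -> nat) :=
  (forall x, x < r -> n - r <= f x < n) /\
  (forall x, n - r <= x < n -> g x < r).

(* f and g are a k-cycle with k = 2r+1 and its inverse, extended to nat by the
   identity; c is the middle label. The fields hooked_exit and hooked_entry are
   equivalent, but having both makes the record symmetric in f and g. *)
Record hooked n r c (f g : nat -> nat) : Prop := Hooked {
  hooked_r : 0 < r;
  hooked_c : r <= c < n - r;
  hooked_fK : cancel f g;
  hooked_gK : cancel g f;
  hooked_supp : forall x, (f x != x) = [|| x < r, n - r <= x < n | x == c];
  hooked_conn : forall (X : pred nat) x y, X x -> ~~ X y -> f x != x ->
    f y != y -> exists2 z, X z & ~~ X (f z);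
  hooked_osc : oriented n r f g \/ oriented n r g f;
  hooked_exit : forall a, unique_exit n a f;
  hooked_entry : forall a, unique_exit n a g }.

(** For connectivity, a crossing of [f] out of the complement of [X], read backwards, is a crossing
    of [g] out of [X]. *)
Lemma hooked_sym n r c f g : hooked n r c f g -> hooked n r c g f.
Proof.
case=> r0 cP fK gK supp conn osc ex en.
have fixE x : (g x != x) = (f x != x).
  by apply/idP/idP; apply: contraNN => /eqP {1}<-; rewrite ?fK ?gK.
split=> // [x|X x y Xx Xy gx gy|]; first by rewrite fixE.
  have [||||z Xz /negPn Xfz] := conn (predC X) y x; rewrite /= ?negbK -?fixE //.
  by exists (f z); rewrite ?fK.
by case: osc; [right | left].
Qed.

Section Hooked.
Variables (n r c : nat) (f g : nat -> nat).
Hypothesis h : hooked n r c f g.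

Lemma hooked_n : r.*2 < n.
Proof. by case: h => r0 cP *; lia. Qed.

Lemma hooked_ltn x : x < n -> f x < n.
Proof.
move=> xn; case: ltnP => // fxn; have := hooked_supp h (f x).
have cP := hooked_c h; have -> : [|| f x < r, n - r <= f x < n | f x == c] = false by lia.
by move/negbFE/eqP/(can_inj (hooked_fK h)) => e; lia.
Qed.

(** In the second orientation [f x] is a moved label, and it is not small, because [g] would send it
    to a large label instead of back to x. *)
Lemma hooked_low x : x < r -> (n - r <= f x < n) || (f x == c).
Proof.
move=> xr; have cP := hooked_c h; have nP := hooked_n.
have [[o1 o2]|[o1 o2]] := hooked_osc h; first by rewrite o1.
have s1 := hooked_supp h x; have s2 := hooked_supp h (f x).
have e : f (f x) != f x by rewrite (can_eq (hooked_fK h)) s1; lia.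
case: (ltnP (f x) r) => fr; last by lia.
by have := o1 _ fr; rewrite (hooked_fK h); lia.
Qed.

Lemma hooked_high x : n - r <= x < n -> (f x < r) || (f x == c).
Proof.
move=> xr; have cP := hooked_c h; have nP := hooked_n.
have [[o1 o2]|[o1 o2]] := hooked_osc h; last by rewrite o2.
have s1 := hooked_supp h x; have s2 := hooked_supp h (f x).
have e : f (f x) != f x by rewrite (can_eq (hooked_fK h)) s1; lia.
case: (boolP (n - r <= f x < n)) => fr; last by lia.
by have := o2 _ fr; rewrite (hooked_fK h); lia.
Qed.

(** By connectivity a 2-cycle would be the whole support, but 0, c and n-1 are three distinct moved
    labels. *)
Lemma hooked_neq2 x : f x != x -> f (f x) != x.
Proof.
move=> fx; apply/eqP => ffx; have cP := hooked_c h; have nP := hooked_n.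
have r0 := hooked_r h.
have [y [ys yx yfx]] : exists y, [/\ f y != y, y != x & y != f x].
  case: (boolP ((0 != x) && (0 != f x))) => [/andP[]|H].
    by exists 0; rewrite (hooked_supp h); split=> //; lia.
  case: (boolP ((c != x) && (c != f x))) => [/andP[]|H'].
    by exists c; rewrite (hooked_supp h); split=> //; lia.
  by exists n.-1; rewrite (hooked_supp h); split=> //; lia.
have [||z /pred2P[->|->]] := @hooked_conn _ _ _ _ _ h (pred2 x (f x)) x y _ _ fx ys.
- by rewrite /= eqxx.
- by rewrite /= (negPf yx) (negPf yfx).
- by rewrite /= eqxx orbT.
- by rewrite /= ffx eqxx.
Qed.

End Hooked.

(** * Conjugation by the mirror and by adjacent transpositions *)

Definition mirror n x := if x < n then n.-1 - x else x.

Definition swap i x := if x == i then i.+1 else if x == i.+1 then i else x.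

Definition conjf (t f : nat -> nat) x := t (f (t x)).

Lemma mirrorP n x :
  x < n /\ mirror n x = n.-1 - x \/ n <= x /\ mirror n x = x.
Proof. by rewrite /mirror; case: ltnP => ?; [left | right]. Qed.

Lemma swapP i x : [\/ x = i /\ swap i x = i.+1, x = i.+1 /\ swap i x = i
  | [/\ x <> i, x <> i.+1 & swap i x = x]].
Proof.
rewrite /swap; case: eqP => ?; first by constructor 1.
by case: eqP => ?; [constructor 2 | constructor 3].
Qed.

Lemma mirrorK n : involutive (mirror n).
Proof. by move=> x; have := mirrorP n x; have := mirrorP n (mirror n x); lia. Qed.

Lemma swapK i : involutive (swap i).
Proof.
move=> x; case: (swapP i x) => [[? H]|[? H]|[? ? H]];
case: (swapP i (swap i x)) => [[? H']|[? H']|[? ? H']]; lia.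
Qed.

Lemma oriented_ext n r f g f' g' :
  f =1 f' -> g =1 g' -> oriented n r f g -> oriented n r f' g'.
Proof.
by move=> e e' [o1 o2]; split=> x; rewrite -?e -?e'; [apply: o1 | apply: o2].
Qed.

Lemma hooked_ext n r c f g f' g' :
  f =1 f' -> g =1 g' -> hooked n r c f g -> hooked n r c f' g'.
Proof.
move=> ef eg [r0 cP fK gK supp conn osc ex en].
split=> // [x|x|x|X x y|||].
- by rewrite -ef -eg.
- by rewrite -ef -eg.
- by rewrite -ef.
- by rewrite -!ef => Xx Xy fx /(conn X _ _ Xx Xy fx)[z Xz ?]; exists z; rewrite -?ef.
- by case: osc => o; [left | right]; apply: oriented_ext o.
- by move=> a x y wx wy; rewrite -!ef; apply: ex.
- by move=> a x y wx wy; rewrite -!eg; apply: en.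
Qed.

Lemma hooked_conj n r c c' f g t : hooked n r c f g -> involutive t ->
  r <= c' < n - r ->
  (forall x, [|| x < r, n - r <= x < n | x == c']
           = [|| t x < r, n - r <= t x < n | t x == c]) ->
  oriented n r (conjf t f) (conjf t g) \/ oriented n r (conjf t g) (conjf t f) ->
  (forall a, unique_exit n a (conjf t f)) ->
  (forall a, unique_exit n a (conjf t g)) ->
  hooked n r c' (conjf t f) (conjf t g).
Proof.
move=> [r0 cP fK gK supp conn _ _ _] tK c'P eqc osc ex en.
have neqE x : (conjf t f x != x) = (f (t x) != t x).
  by rewrite -[in RHS](can_eq tK) tK.
split=> // [x|x|x|X x y Xx Xy].
- by rewrite /conjf tK fK tK.
- by rewrite /conjf tK gK tK.
- by rewrite neqE supp eqc.
- rewrite !neqE => fx fy.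
  have [||z Xz Xfz] := conn (X \o t) _ _ _ _ fx fy; rewrite /= ?tK //.
  by exists (t z); rewrite /conjf ?tK.
Qed.

Lemma window_mirror n a x : window n a (mirror n x) = window n a x.
Proof. by rewrite /window; have := mirrorP n x; lia. Qed.

(** The mirror exchanges small and large labels, hence the roles of [f] and [g]. *)
Lemma oriented_mirror n r f g : r.*2 < n -> oriented n r f g ->
  oriented n r (conjf (mirror n) g) (conjf (mirror n) f).
Proof.
move=> nP [o1 o2]; split=> x xr; rewrite /conjf.
- by have := o2 (mirror n x); have := mirrorP n x; have := mirrorP n (g (mirror n x)); lia.
- by have := o1 (mirror n x); have := mirrorP n x; have := mirrorP n (f (mirror n x)); lia.
Qed.

Lemma unique_exit_mirror n a f :
  unique_exit n a f -> unique_exit n a (conjf (mirror n) f).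
Proof.
move=> ex x y wx wy; rewrite /conjf !window_mirror => fx fy.
by apply: (can_inj (@mirrorK n)); apply: ex => //; rewrite window_mirror.
Qed.

Lemma hooked_mirror n r c f g : hooked n r c f g ->
  hooked n r (n.-1 - c) (conjf (mirror n) f) (conjf (mirror n) g).
Proof.
move=> h; have cP := hooked_c h; have nP := hooked_n h.
apply: (hooked_conj h (@mirrorK n)).
- lia.
- by move=> x; have := mirrorP n x; lia.
- by case: (hooked_osc h) => /(oriented_mirror nP); [right | left].
- by move=> a; apply/unique_exit_mirror/(hooked_exit h).
- by move=> a; apply/unique_exit_mirror/(hooked_entry h).
Qed.

(* The window has r - a small and r - a large labels; under the stated assumptions
   g would map its large labels injectively to its small labels other than x. *)
Lemma window_ends_high n r c f g a x y : hooked n r c f g -> a <= r ->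
  window n a x -> window n a y ->
  ~~ window n a (f x) -> ~~ window n a (g y) ->
  n - r <= f x < n -> n - r <= g y < n -> False.
Proof.
move=> h; have nP := hooked_n h; have cP := hooked_c h.
wlog o : f g x y h / oriented n r f g.
  move=> W; case: (hooked_osc h) => o ar wx wy fx gy lx ly.
    exact: (W f g x y).
  exact: (W g f y x (hooked_sym h)).
move=> ar; rewrite /window => wx wy fx gy lx ly.
have xr : x < r by have := o.2 (f x) lx; rewrite (hooked_fK h).
have yr : ~~ (n - r <= y < n).
  by apply/negP => /(o.2 _); lia.
have gin z : n - r <= z < n - a -> a <= g z < r.
  move=> zP; have gz : g z < r by apply: o.2; lia.
  case: (leqP a (g z)) => // ga.
  have /eqP : z == y by apply/eqP; apply: (hooked_entry h) (a) _ _ _ _ _ _; rewrite /window; lia.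
  lia.
pose s := x :: [seq g z | z <- iota (n - r) (r - a)].
have us : uniq s.
  rewrite /= map_inj_uniq ?iota_uniq; last exact: can_inj (hooked_gK h).
  rewrite andbT; apply/mapP => -[z]; rewrite mem_iota => zP xz.
  by move: fx; rewrite xz (hooked_gK h); lia.
have /(uniq_leq_size us) : {subset s <= iota a (r - a)}.
  move=> z; rewrite inE => /predU1P[->|/mapP[w]]; rewrite !mem_iota; first lia.
  by move=> wP ->; have := gin w; lia.
by rewrite /= size_map !size_iota; lia.
Qed.

(** * Attachment of a level to the window inside it *)

Section Levels.
Variables (n r c : nat) (f g : nat -> nat).
Hypothesis h : hooked n r c f g.

(** If no neighbour of i lies in the inner window, then for i > 0 both lie outside [i, i*], so i is
    an exit and an entry of that window. By connectivity the rest of the window, which contains c,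
    has a second exit or an arrow into i; both are impossible. For i = 0 both neighbours would equal
    n-1. *)
Lemma adjacent_low i : i < r ->
  (f i != n.-1 - i) && (g i != n.-1 - i) || (i == 0) ->
  window n i.+1 (f i) || window n i.+1 (g i).
Proof.
have nP := hooked_n h; have cP := hooked_c h; move=> ir H.
apply/negP => /negP; rewrite negb_or => /andP[Nf Ng].
have fi := hooked_low h ir; have gi := hooked_low (hooked_sym h) ir.
have fi0 : f i != i by rewrite (hooked_supp h) ir.
have fgi : f i != g i.
  apply/eqP => e; have := hooked_neq2 h fi0.
  by rewrite e (hooked_gK h) eqxx.
have [i0|i0] := posnP i.
  by clear H; move: Nf Ng; rewrite /window; lia.
have {H} [Hf Hg] : f i != n.-1 - i /\ g i != n.-1 - i by clear -H i0; lia.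
have wf : ~~ window n i (f i).
  by clear gi Ng Hg fgi; move: Nf; rewrite /window; lia.
have wg : ~~ window n i (g i).
  by clear fi Nf Hf fgi wf fi0; move: Ng; rewrite /window; lia.
have wi : window n i i by rewrite /window; lia.
have [||||z] := @hooked_conn _ _ _ _ _ h (fun z => window n i z && (z != i)) c i.
- by rewrite /window; lia.
- by rewrite eqxx andbF.
- by rewrite (hooked_supp h) eqxx !orbT.
- by [].
move=> /andP[wz zi]; rewrite negb_and negbK => /orP[wfz|/eqP fz].
  by rewrite (hooked_exit h wz wi wfz wf) eqxx in zi.
by move: wz; rewrite -[z](hooked_fK h) fz (negPf wg).
Qed.

End Levels.

Section LevelsHigh.
Variables (n r c : nat) (f g : nat -> nat).
Hypothesis h : hooked n r c f g.

Lemma window_ends_low a x y : a <= r -> window n a x -> window n a y ->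
  ~~ window n a (f x) -> ~~ window n a (g y) -> f x < r -> g y < r -> False.
Proof.
have nP := hooked_n h.
move=> ar wx wy fx gy lx ly.
apply: (window_ends_high (hooked_mirror h) ar (x := mirror n x) (y := mirror n y));
  rewrite /conjf ?window_mirror ?mirrorK ?window_mirror //.
- by have := mirrorP n (f x); lia.
- by have := mirrorP n (g y); lia.
Qed.

Lemma adjacent_high i : i < r ->
  (f i != n.-1 - i) && (g i != n.-1 - i) || (i == 0) ->
  window n i.+1 (f (n.-1 - i)) || window n i.+1 (g (n.-1 - i)).
Proof.
have nP := hooked_n h.
move=> ir H; have := adjacent_low (hooked_mirror h) ir.
have mi : mirror n i = n.-1 - i by have := mirrorP n i; lia.
rewrite /conjf !window_mirror mi; apply.
have fin : f (n.-1 - i) < n by apply: (hooked_ltn h); lia.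
have gin : g (n.-1 - i) < n by apply: (hooked_ltn (hooked_sym h)); lia.
case/orP: H => [/andP[H1 H2]|->]; last by rewrite orbT.
have E u v : cancel u v -> v i != n.-1 - i -> u (n.-1 - i) < n ->
    mirror n (u (n.-1 - i)) != n.-1 - i.
  move=> uK vi un; apply: contraNN vi => /eqP e.
  have ui : u (n.-1 - i) = i by have := mirrorP n (u (n.-1 - i)); lia.
  by rewrite -[in v i]ui uK.
by rewrite (E _ _ (hooked_fK h) H2 fin) (E _ _ (hooked_gK h) H1 gin).
Qed.

End LevelsHigh.

(** * Invariance under length-preserving swaps *)

Definition one_exit (P : pred nat) (f : nat -> nat) :=
  exists e, forall x, P x -> ~~ P (f x) -> x = e.

(* The preimage of the window [i+1, (i+1)*] under the swap of i and i+1. *)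
Definition swap_window n i x :=
  window n i.+1 x && (x != i.+1) || (x == i).

Section SwapLow.
Variables (n r c i : nat).
Hypothesis ir : i.+1 < r.

(* Here i+1 is not adjacent to the inner window [i+2, (i+2)*]. *)
Lemma swap_window_outer f g : hooked n r c f g ->
  f i.+1 = n.-1 - i.+1 -> ~~ window n i.+2 (g i.+1) ->
  (f i < f i.+1) != (g i < g i.+1) ->
  one_exit (swap_window n i) f /\ one_exit (swap_window n i) g.
Proof.
move=> h fa Ng al; have nP := hooked_n h; have cP := hooked_c h.
have h' := hooked_sym h.
have fa0 : f i.+1 != i.+1 by rewrite (hooked_supp h); lia.
have gn : g i.+1 != n.-1 - i.+1.
  by apply/eqP => e; move: (hooked_neq2 h fa0); rewrite fa -e (hooked_gK h) eqxx.
(* With a = i+1, the label before a lies beyond a*, so the window [a, a*] is entered at a. *)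
have ga : n - i.+1 <= g i.+1 < n.
  by have := hooked_low h' ir; move: Ng gn; rewrite /window; clear -nP cP ir; lia.
have fi := hooked_low h (ltnW ir); have gi := hooked_low h' (ltnW ir).
have fin : f i != n.-1 - i.+1.
  by rewrite -fa (can_eq (hooked_fK h)); lia.
have wa : window n i.+1 i.+1 by rewrite /window; lia.
have wga : ~~ window n i.+1 (g i.+1) by rewrite /window; lia.
have wi : ~~ window n i.+1 i by rewrite /window; lia.
have Nfi : ~~ window n i.+1 (f i).
  apply/negP => wf; have := hooked_entry h wf wa.
  by rewrite (hooked_fK h) => /(_ wi wga); clear -fi ir cP nP; lia.
have {al} gilt : g i < g i.+1.
  move: al; rewrite fa; clear -fi Nfi fin nP cP ir; move: Nfi; rewrite /window.
  by case: (g i < g i.+1) => //; lia.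
have gifix : f i != i by rewrite (hooked_supp h); lia.
(* Otherwise a is the only entry of [i, i*], which forces [g i] to be i*. The label before i* is
   then an exit of [a, a*] to a large label, while a is entered from a large label, against
   [window_ends_high]. *)
have wgi : window n i.+1 (g i).
  apply/negPn/negP => Ngi.
  have gi' : n - i.+1 <= g i by move: Ngi; clear -gi ir cP nP; rewrite /window; lia.
  have ent x : window n i x -> x != i.+1 -> window n i (g x).
    move=> wx xa; apply/negPn/negP => Nx; case/eqP: xa.
    by apply: (hooked_entry h wx) => //; rewrite /window; clear -ga gilt gi' nP ir; lia.
  have gii : g i = n - i.+1.
    have : window n i (g i) by apply: ent; rewrite /window; clear -nP ir; lia.
    by clear -gi' nP ir; rewrite /window; lia.
  have fii : f (n - i.+1) = i by rewrite -gii (hooked_gK h).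
  have gw : window n i (g (n - i.+1)).
    by apply: ent; rewrite /window; clear -nP ir; lia.
  have gh : (g (n - i.+1) < r) || (g (n - i.+1) == c).
    by apply: (hooked_high h'); clear -nP ir; lia.
  have gne : g (n - i.+1) != i.
    apply/eqP => e; have := hooked_neq2 h' (x := i).
    by rewrite gii e eqxx; clear -nP ir; lia.
  apply: (window_ends_high h (a := i.+1) (x := g (n - i.+1)) (y := i.+1));
    rewrite ?(hooked_gK h) //; first exact: ltnW.
  - by move: gw; rewrite /window; clear -gh gne nP cP ir; lia.
  - by rewrite /window; clear -nP ir; lia.
  - by clear -nP ir; lia.
  - by clear -ga ir nP; lia.
have gia : g i != i.+1 by clear -gi nP cP ir; lia.
(* The arc of [a, a*] runs a, a*, ..., [g i] and is followed by i; dropping a and adding i leaves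
   the arc from a* to i. *)
split.
  exists i => x /orP[/andP[wx xa]|/eqP //].
  rewrite negb_or negb_and negbK => /andP[/orP[Nfx|/eqP fxa] fxi].
    have xgi : x = g i.
      by apply: (hooked_exit h wx wgi Nfx); rewrite (hooked_gK h).
    by rewrite xgi (hooked_gK h) eqxx in fxi.
  by rewrite -[in g _]fxa (hooked_fK h) wx in wga.
exists (n.-1 - i.+1) => x /orP[/andP[wx xa]|/eqP ->]; last first.
  by rewrite /swap_window wgi gia.
rewrite negb_or negb_and negbK => /andP[/orP[Nfx|/eqP fxa] fxi].
  by rewrite (hooked_entry h wx wa Nfx wga) eqxx in xa.
by rewrite -fa -fxa (hooked_gK h).
Qed.

(* Here the inner window and i+1 are adjacent, but i+1 and (i+1)* are not. *)
Lemma swap_window_inner f g : hooked n r c f g ->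
  f i.+1 != n.-1 - i.+1 -> window n i.+2 (g i.+1) ->
  (f i < f i.+1) != (g i < g i.+1) ->
  one_exit (swap_window n i) f /\ one_exit (swap_window n i) g.
Proof.
move=> h fa wga al; have nP := hooked_n h; have cP := hooked_c h.
have h' := hooked_sym h.
have Na : ~~ window n i.+2 i.+1 by rewrite /window; lia.
have Ni : ~~ window n i.+2 i by rewrite /window; lia.
have Na' : ~~ window n i.+2 (n.-1 - i.+1) by rewrite /window; lia.
have ga : g i.+1 != n.-1 - i.+1 by apply: contraNneq Na' => <-.
have aa' : i.+1 != n.-1 - i.+1 by lia.
have ia' : i != n.-1 - i.+1 by lia.
have ex2 x y : window n i.+2 (g x) -> window n i.+2 (g y) ->
    ~~ window n i.+2 x -> ~~ window n i.+2 y -> x = y.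
  move=> wx wy Nx Ny; apply: (can_inj (hooked_gK h)).
  by apply: (hooked_exit h wx wy); rewrite (hooked_gK h).
have en2 x y : window n i.+2 (f x) -> window n i.+2 (f y) ->
    ~~ window n i.+2 x -> ~~ window n i.+2 y -> x = y.
  move=> wx wy Nx Ny; apply: (can_inj (hooked_fK h)).
  by apply: (hooked_entry h wx wy); rewrite (hooked_fK h).
have Nga' : ~~ window n i.+2 (g (n.-1 - i.+1)).
  by apply: contraNN aa' => w; apply/eqP/ex2.
(* With a = i+1, the label a* is not adjacent to a, so it is attached to the inner window, whose
   exit leads to a. *)
have wfa' : window n i.+2 (f (n.-1 - i.+1)).
  have := adjacent_high h ir; rewrite fa ga (negPf Nga') orbF; exact.
have Nfa : ~~ window n i.+2 (f i.+1).
  by apply: contraNN aa' => w; apply/eqP/en2.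
have Nfi : ~~ window n i.+2 (f i).
  by apply: contraNN ia' => w; apply/eqP/en2.
have Ngi : ~~ window n i.+2 (g i).
  by apply/negP => w; have := ex2 _ _ w wga Ni Na; clear; lia.
have fi := hooked_low h (ltnW ir); have gi := hooked_low h' (ltnW ir).
have fal := hooked_low h ir.
have {fal} fal : n - i.+1 <= f i.+1 < n.
  by move: Nfa; rewrite /window; clear -fal fa ir nP cP; lia.
have {al} filt : f i < f i.+1.
  move: al wga Ngi; clear -gi nP cP ir; rewrite /window.
  by case: (f i < f i.+1) => //; lia.
have ga'h : (g (n.-1 - i.+1) < r) || (g (n.-1 - i.+1) == c).
  by apply: (hooked_high h'); clear -nP ir; lia.
have ga'a : g (n.-1 - i.+1) != i.+1.
  by apply: contraNN fa => /eqP e; rewrite -[in f _]e (hooked_gK h).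
have wa : window n i.+1 i.+1 by rewrite /window; clear -ir nP; lia.
have wfa : ~~ window n i.+1 (f i.+1) by rewrite /window; clear -fal ir nP; lia.
have wa' : window n i.+1 (n.-1 - i.+1) by rewrite /window; clear -ir nP; lia.
have wga' : ~~ window n i.+1 (g (n.-1 - i.+1)).
  by move: Nga'; rewrite /window; clear -ga'h ga'a cP ir nP; lia.
have fifix : f i != i by rewrite (hooked_supp h) (ltnW ir).
(* Otherwise [f i] lies beyond a*, a is the only exit of [i, i*], and [f i] is i*. The image of i*
   is then an entry of [a, a*], hence equal to a*, although a large label has no large image. *)
have fia' : f i = n.-1 - i.+1.
  apply/eqP/negPn/negP => fin.
  have fi' : n - i.+1 <= f i.
    by move: Nfi; rewrite /window; clear -fi fin ir cP nP; lia.
  have ext x : window n i x -> x != i.+1 -> window n i (f x).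
    move=> wx xa; apply/negPn/negP => Nx; case/eqP: xa.
    by apply: (hooked_exit h wx) => //; rewrite /window; clear -fal filt fi' nP ir; lia.
  have fii : f i = n - i.+1.
    have : window n i (f i) by apply: ext; rewrite /window; clear -nP ir; lia.
    by clear -fi' nP ir; rewrite /window; lia.
  have fw : window n i (f (n - i.+1)).
    by apply: ext; rewrite /window; clear -nP ir; lia.
  have fh : (f (n - i.+1) < r) || (f (n - i.+1) == c).
    by apply: (hooked_high h); clear -nP ir; lia.
  have fne : f (n - i.+1) != i by rewrite -fii (hooked_neq2 h).
  have wf : window n i.+1 (f (n - i.+1)).
    by move: fw; rewrite /window; clear -fh fne nP cP ir; lia.
  have := hooked_entry h wf wa'; rewrite (hooked_fK h).
  have Nw : ~~ window n i.+1 (n - i.+1) by rewrite /window; clear -nP ir; lia.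
  by move=> /(_ Nw wga') e; move: fh; rewrite e; clear -nP cP ir; lia.
(* The cycle reads i, a*, the inner arc, a; dropping a and adding i leaves an arc from i to
   [g i.+1]. *)
split.
  exists (g i.+1) => x /orP[/andP[wx xa]|/eqP ->]; last first.
    by rewrite fia' /swap_window wa' eq_sym aa'.
  rewrite negb_or negb_and negbK => /andP[/orP[Nfx|/eqP fxa] fxi].
    by rewrite (hooked_exit h wx wa Nfx wfa) eqxx in xa.
  by rewrite -fxa (hooked_fK h).
exists i => x /orP[/andP[wx xa]|/eqP //].
rewrite negb_or negb_and negbK => /andP[/orP[Ngx|/eqP gxa] gxi].
  have := hooked_entry h wx wa' Ngx wga' => e.
  by rewrite e -fia' (hooked_fK h) eqxx in gxi.
by rewrite -[in f _]gxa (hooked_gK h) wx in wfa.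
Qed.

(** Label i+1 is adjacent to its mirror image or to the inner window, and the two lemmas above treat
    these cases separately. By [key] they cannot occur on opposite sides of i+1: mixedness would put
    [u i] in the inner window, which would be both entered from and left to a small label. *)
Lemma swap_window_exit f g : hooked n r c f g ->
  (f i < f i.+1) != (g i < g i.+1) ->
  one_exit (swap_window n i) f /\ one_exit (swap_window n i) g.
Proof.
move=> h al; have nP := hooked_n h; have cP := hooked_c h.
have h' := hooked_sym h.
have al' : (g i < g i.+1) != (f i < f i.+1) by rewrite eq_sym.
have key u v : hooked n r c u v -> (u i < u i.+1) != (v i < v i.+1) ->
    window n i.+2 (v i.+1) -> u i.+1 = n.-1 - i.+1 -> False.
  move=> hu alu wv uE.
  have ui := hooked_low hu (ltnW ir); have vi := hooked_low (hooked_sym hu) (ltnW ir).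
  have Na : ~~ window n i.+2 i.+1 by rewrite /window; lia.
  have Ni : ~~ window n i.+2 i by rewrite /window; lia.
  have Nvi : ~~ window n i.+2 (v i).
    apply/negP => w; have := hooked_exit hu w wv.
    rewrite !(hooked_gK hu) => /(_ Ni Na) /(can_inj (hooked_gK hu)); lia.
  have uil : u i < u i.+1.
    move: alu wv Nvi; clear -vi nP cP ir; rewrite /window.
    by case: (u i < u i.+1) => //; lia.
  apply: (window_ends_low hu (a := i.+2) (x := v i.+1) (y := u i));
    rewrite ?(hooked_fK hu) ?(hooked_gK hu) //; last exact: ltnW.
  by move: uil; rewrite uE /window; clear -ui nP cP ir; lia.
have inner u v : hooked n r c u v -> (u i < u i.+1) != (v i < v i.+1) ->
    window n i.+2 (v i.+1) ->
    one_exit (swap_window n i) u /\ one_exit (swap_window n i) v.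
  move=> hu alu wv; apply: swap_window_inner => //.
  by apply/eqP; apply: key hu _ _.
case: (boolP (window n i.+2 (g i.+1))) => [|Ng]; first exact: inner.
case: (boolP (window n i.+2 (f i.+1))) => [/(inner _ _ h' al')[]//|Nf].
case: (eqVneq (f i.+1) (n.-1 - i.+1)) => [fa|fa]; first exact: swap_window_outer.
case: (eqVneq (g i.+1) (n.-1 - i.+1)) => [ga|ga].
  by case: (swap_window_outer h' ga Nf al').
by have := adjacent_low h ir; rewrite fa ga (negPf Nf) (negPf Ng) => /(_ isT).
Qed.

End SwapLow.

(* The condition for conjugation by the swap of i and i+1 to preserve the length. *)
Definition mixed_swap i (f g : nat -> nat) :=
  (f i < f i.+1) != (g i < g i.+1).

Lemma mixed_swapC i f g : mixed_swap i f g = mixed_swap i g f.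
Proof. by rewrite /mixed_swap eq_sym. Qed.

(** [f c] is a moved label other than c, and it is not large, since [g] sends large labels to small
    ones; dually for [g c]. *)
Lemma oriented_low_mid n r c f g : hooked n r c f g -> oriented n r f g ->
  f c < r /\ n - r <= g c < n.
Proof.
move=> h [o1 o2]; have cP := hooked_c h; have nP := hooked_n h.
have fc : f c != c by rewrite (hooked_supp h) eqxx !orbT.
have gc : g c != c by rewrite (hooked_supp (hooked_sym h)) eqxx !orbT.
have ffc : f (f c) != f c by rewrite (can_eq (hooked_fK h)).
have ggc : g (g c) != g c by rewrite (can_eq (hooked_gK h)).
rewrite (hooked_supp h) (negPf fc) orbF in ffc.
rewrite (hooked_supp (hooked_sym h)) (negPf gc) orbF in ggc.
split.
  case/orP: ffc => // /o2; rewrite (hooked_fK h); clear -cP; lia.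
by case/orP: ggc => // /o1; rewrite (hooked_gK h); clear -cP; lia.
Qed.

Lemma oriented_swap n r i f g : r.*2 < n -> i.+1 < n -> i.+1 != r ->
  i.+1 != n - r -> oriented n r f g ->
  oriented n r (conjf (swap i) f) (conjf (swap i) g).
Proof.
move=> nP ilt ir inr [o1 o2].
have low x : (swap i x < r) = (x < r).
  by clear o1 o2; case: (swapP i x) => -[]; lia.
have high x : (n - r <= swap i x < n) = (n - r <= x < n).
  by clear o1 o2; case: (swapP i x) => -[]; lia.
by split=> x xr; rewrite /conjf ?low ?high; [apply: o1; rewrite low | apply: o2; rewrite high].
Qed.

Lemma unique_exit_conj n a f t : involutive t ->
  (forall x, window n a (t x) = window n a x) ->
  unique_exit n a f -> unique_exit n a (conjf t f).
Proof.
move=> tK tw ex x y wx wy; rewrite /conjf !tw => fx fy.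
by apply: (can_inj tK); apply: ex => //; rewrite tw.
Qed.

(** A window of level at least r contains no moved label except possibly c. *)
Lemma unique_exit_inner n r a c f :
  (forall x, f x != x -> [|| x < r, n - r <= x < n | x == c]) ->
  r <= a -> unique_exit n a f.
Proof.
move=> supp ra x y wx wy fx fy.
have E z : window n a z -> ~~ window n a (f z) -> z = c.
  move=> wz fz; have : f z != z by apply: contraNneq fz => ->.
  by move/supp; move: wz; rewrite /window; clear -ra; lia.
by rewrite (E x) // (E y).
Qed.

(** The swap changes only windows with a boundary between i and i+1; those of level at least r are
    covered by [unique_exit_inner]. *)
Lemma unique_exit_swap n r c f i a : (a != i.+1) || (r <= a) ->
  (a != n - i.+1) || (r <= a) -> i.+1 < n ->
  (forall x, conjf (swap i) f x != x -> [|| x < r, n - r <= x < n | x == c]) ->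
  unique_exit n a f -> unique_exit n a (conjf (swap i) f).
Proof.
move=> a1 a2 ilt supp ex; case: (leqP r a) => ra; first exact: unique_exit_inner supp ra.
apply: unique_exit_conj => //; first exact: swapK.
by move=> x; rewrite /window; clear ex supp; case: (swapP i x) => -[]; lia.
Qed.

Lemma conjf_supp n r c c' f g t : hooked n r c f g -> involutive t ->
  (forall x, [|| x < r, n - r <= x < n | x == c']
           = [|| t x < r, n - r <= t x < n | t x == c]) ->
  forall x, conjf t f x != x -> [|| x < r, n - r <= x < n | x == c'].
Proof.
by move=> h tK e x; rewrite e -(hooked_supp h) -[in X in X -> _](can_eq tK) tK.
Qed.

Lemma one_exit_swap n i f : i.+1.*2 < n -> one_exit (swap_window n i) f ->
  unique_exit n i.+1 (conjf (swap i) f).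
Proof.
move=> nP [e eP].
have E x : window n i.+1 (swap i x) = swap_window n i x.
  by clear eP; rewrite /swap_window /window; case: (swapP i x) => -[]; lia.
move=> x y wx wy; rewrite /conjf !E => fx fy.
apply: (can_inj (@swapK i)); transitivity e; last symmetry;
by apply: eP => //; rewrite -E swapK.
Qed.

Lemma hooked_swap_low n r c i f g : hooked n r c f g -> i.+1 < r ->
  mixed_swap i f g -> hooked n r c (conjf (swap i) f) (conjf (swap i) g).
Proof.
move=> h ir al; have nP := hooked_n h; have cP := hooked_c h.
have suppE x : [|| x < r, n - r <= x < n | x == c]
             = [|| swap i x < r, n - r <= swap i x < n | swap i x == c].
  by clear h al; case: (swapP i x) => -[]; lia.
have [ef eg] := swap_window_exit ir h al.
have ex u v a : hooked n r c u v -> one_exit (swap_window n i) u ->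
    unique_exit n a (conjf (swap i) u).
  move=> hu eu; case: (eqVneq a i.+1) => [->|ai].
    by apply: one_exit_swap eu; clear -ir nP; lia.
  apply: (@unique_exit_swap n r c u i a _ _ _ _ (@hooked_exit _ _ _ _ _ hu a));
    try by clear -ir nP ai; lia.
  exact: conjf_supp hu (@swapK i) suppE.
apply: (hooked_conj h (@swapK i) cP suppE).
- by case: (hooked_osc h) => o; [left | right];
    apply: oriented_swap; rewrite //; clear -ir nP; lia.
- by move=> a; apply: ex h ef.
- by move=> a; apply: ex (hooked_sym h) eg.
Qed.

Lemma hooked_swap_mid n r c i f g : hooked n r c f g -> r <= i -> i.+1 < n - r ->
  hooked n r (swap i c) (conjf (swap i) f) (conjf (swap i) g).
Proof.
move=> h ri inr; have nP := hooked_n h; have cP := hooked_c h.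
have suppE x : [|| x < r, n - r <= x < n | x == swap i c]
             = [|| swap i x < r, n - r <= swap i x < n | swap i x == c].
  by clear h; case: (swapP i x) => -[]; case: (swapP i c) => -[]; lia.
have ex u v a : hooked n r c u v -> unique_exit n a (conjf (swap i) u).
  move=> hu; apply: (@unique_exit_swap n r (swap i c) u i a _ _ _ _ (@hooked_exit _ _ _ _ _ hu a));
    try by clear -ri inr nP; lia.
  exact: conjf_supp hu (@swapK i) suppE.
apply: (hooked_conj h (@swapK i) _ suppE).
- by clear -cP ri inr; case: (swapP i c) => -[]; lia.
- by case: (hooked_osc h) => o; [left | right];
    apply: oriented_swap; rewrite //; clear -ri inr nP; lia.
- by move=> a; apply: ex h.
- by move=> a; apply: ex (hooked_sym h).
Qed.

(** Around c the cycle reads: large label, c, i, large label. After exchanging c and i, every large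
    label points to a small one and i points to c, which is the opposite orientation. *)
Lemma oriented_swap_edge n r c i f g : hooked n r c f g -> i.+1 = r -> c = r ->
  mixed_swap i f g -> oriented n r f g ->
  oriented n r (conjf (swap i) g) (conjf (swap i) f).
Proof.
move=> h ir cr al o; have nP := hooked_n h; have [fc gc] := oriented_low_mid h o.
have fi : n - r <= f i < n by apply: o.1; lia.
have {al} gic : g i < g c.
  by move: al; rewrite /mixed_swap ir -cr; clear -fi fc nP; case: (g i < g c) => //; lia.
have gi : (n - r <= g i < n) || (g i == c).
  by apply: (hooked_low (hooked_sym h)); rewrite -ir.
have wi : window n i i by rewrite /window; clear -ir nP; lia.
have wc : window n i c by rewrite /window; clear -ir cr nP; lia.
(* If [g i] is large, then i and c are two entries of [i, i*] when [f i] is i*, two exits when [g i]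
   is i*, and otherwise i is not attached to [r, r*], against [adjacent_low]. *)
have {gi} gi : g i = c.
  case/orP: gi => [gi|/eqP //].
  have fin : f i < n by clear -fi; lia.
  have [fii|fii] := eqVneq (f i) (n.-1 - i).
    have gn : g i != n.-1 - i.
      apply/eqP => e; have := hooked_neq2 h (x := i).
      by rewrite fii -{2}e (hooked_gK h) eqxx; clear -nP ir; lia.
    have Ngi : ~~ window n i (g i) by rewrite /window; clear -gi gn ir nP; lia.
    have Ngc : ~~ window n i (g c) by rewrite /window; clear -gi gn gic ir nP; lia.
    by have := hooked_entry h wi wc Ngi Ngc; clear -ir cr; lia.
  have [gii|gii] := eqVneq (g i) (n.-1 - i).
    have Nfi : ~~ window n i (f i) by rewrite /window; clear -fi fii ir nP; lia.
    have fci : f c != i.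
      by apply/eqP => e; move: gi; rewrite -e (hooked_fK h) cr; clear -nP; lia.
    have Nfc : ~~ window n i (f c) by rewrite /window; clear -fc fci ir nP; lia.
    by have := hooked_exit h wi wc Nfi Nfc; clear -ir cr; lia.
  have ir' : i < r by rewrite -ir.
  have := adjacent_low h ir'; rewrite fii gii => /(_ isT).
  by rewrite /window; clear -fi gi ir nP; lia.
have fci : f c = i by rewrite -gi (hooked_gK h).
split=> x xr; rewrite /conjf.
  have gx : (n - r <= g (swap i x) < n).
    case: (swapP i x) => [[xi ->]|[xi _]|[xi _ ->]]; first by rewrite (_ : i.+1 = c) // ir cr.
      by clear -xi xr ir; lia.
    case/orP: (hooked_low (hooked_sym h) xr) => // /eqP e.
    by case: xi; rewrite -fci -e (hooked_gK h).
  by case: (swapP i (g (swap i x))) => -[]; clear -gx ir nP; lia.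
have -> : swap i x = x by case: (swapP i x) => -[]; clear -xr ir nP; lia.
have fxi : f x != i.
  by apply/eqP => e; move: xr; rewrite -(hooked_fK h x) e gi cr; clear -nP; lia.
have := hooked_high h xr; case: (swapP i (f x)) => -[]; clear -ir cr fxi; lia.
Qed.

Lemma hooked_swap_edge n r c i f g : hooked n r c f g -> i.+1 = r ->
  mixed_swap i f g ->
  c = r /\ hooked n r c (conjf (swap i) f) (conjf (swap i) g).
Proof.
move=> h ir al; have nP := hooked_n h; have cP := hooked_c h.
(* Otherwise r is fixed while both neighbours of r-1 exceed r, so the swap is not mixed. *)
have cr : c = r.
  apply/eqP/negPn/negP => cr; have ir' : i < r by rewrite -ir.
  have fi := hooked_low h ir'; have gi := hooked_low (hooked_sym h) ir'.
  have fr : f r == r by rewrite -[_ == _]negbK (hooked_supp h); clear -nP cr; lia.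
  have gr : g r == r.
    by rewrite -[_ == _]negbK (hooked_supp (hooked_sym h)); clear -nP cr; lia.
  by move: al; rewrite /mixed_swap ir (eqP fr) (eqP gr); clear -fi gi cP cr nP; lia.
split=> //.
have suppE x : [|| x < r, n - r <= x < n | x == c]
             = [|| swap i x < r, n - r <= swap i x < n | swap i x == c].
  by clear h al; case: (swapP i x) => -[]; lia.
have ex u v a : hooked n r c u v -> unique_exit n a (conjf (swap i) u).
  move=> hu; apply: (@unique_exit_swap n r c u i a _ _ _ _ (@hooked_exit _ _ _ _ _ hu a));
    try by clear -ir nP; lia.
  exact: conjf_supp hu (@swapK i) suppE.
apply: (hooked_conj h (@swapK i) cP suppE).
- case: (hooked_osc h) => o; [right | left].
    exact: oriented_swap_edge h ir cr al o.
  by apply: oriented_swap_edge (hooked_sym h) ir cr _ o; rewrite mixed_swapC.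
- by move=> a; apply: ex h.
- by move=> a; apply: ex (hooked_sym h).
Qed.

Lemma conjf_mirror_swap n i f : i.+1 < n ->
  conjf (mirror n) (conjf (swap (n.-2 - i)) (conjf (mirror n) f))
    =1 conjf (swap i) f.
Proof.
move=> ilt x.
have E y : mirror n (swap (n.-2 - i) (mirror n y)) = swap i y.
  have := mirrorP n y; have := mirrorP n (swap (n.-2 - i) (mirror n y)).
  by case: (swapP (n.-2 - i) (mirror n y)) => -[]; case: (swapP i y) => -[]; lia.
by rewrite /conjf E E.
Qed.

Lemma mixed_swap_mirror n r c f g i : hooked n r c f g -> i.+1 < n ->
  mixed_swap (n.-2 - i) (conjf (mirror n) f) (conjf (mirror n) g)
    = mixed_swap i f g.
Proof.
move=> h ilt; rewrite /mixed_swap /conjf.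
have -> : mirror n (n.-2 - i) = i.+1 by have := mirrorP n (n.-2 - i); lia.
have -> : mirror n (n.-2 - i).+1 = i by have := mirrorP n (n.-2 - i).+1; lia.
have E u v : hooked n r c u v ->
    (mirror n (u i.+1) < mirror n (u i)) = (u i < u i.+1).
  move=> hu; have := hooked_ltn hu (ltnW ilt); have := hooked_ltn hu ilt.
  by have := mirrorP n (u i); have := mirrorP n (u i.+1); clear; lia.
by rewrite (E _ _ h) (E _ _ (hooked_sym h)).
Qed.

Lemma hooked_swap_mirror n r c c' f g i : hooked n r c f g -> i.+1 < n ->
  hooked n r c' (conjf (swap (n.-2 - i)) (conjf (mirror n) f))
                (conjf (swap (n.-2 - i)) (conjf (mirror n) g)) ->
  hooked n r (n.-1 - c') (conjf (swap i) f) (conjf (swap i) g).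
Proof.
move=> h ilt /hooked_mirror; apply: hooked_ext; exact: conjf_mirror_swap.
Qed.

Lemma hooked_swap_high n r c i f g : hooked n r c f g -> n - r <= i -> i.+1 < n ->
  mixed_swap i f g -> hooked n r c (conjf (swap i) f) (conjf (swap i) g).
Proof.
move=> h ir ilt; rewrite -(mixed_swap_mirror h ilt) => al.
have cP := hooked_c h; have nP := hooked_n h.
have -> : c = n.-1 - (n.-1 - c) by clear -cP; lia.
apply: (hooked_swap_mirror h ilt).
by apply: (hooked_swap_low (hooked_mirror h) _ al); clear -ir ilt nP; lia.
Qed.

(** Both labels are small, middle or large, or they straddle one of the two boundaries between these
    zones; the upper cases are mirror images of the lower ones. *)
Lemma hooked_swap n r c i f g : hooked n r c f g -> i.+1 < n ->
  mixed_swap i f g ->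
  exists c', hooked n r c' (conjf (swap i) f) (conjf (swap i) g).
Proof.
move=> h ilt al; have nP := hooked_n h.
case: (ltngtP i.+1 r) => ir.
- by exists c; apply: hooked_swap_low.
- case: (ltngtP i.+1 (n - r)) => inr.
  + by exists (swap i c); apply: hooked_swap_mid.
  + by exists c; apply: hooked_swap_high.
  exists (n.-1 - (n.-1 - c)); apply: (hooked_swap_mirror h ilt).
  rewrite -(mixed_swap_mirror h ilt) in al.
  have ir' : (n.-2 - i).+1 = r by clear -inr nP ilt; lia.
  by case: (hooked_swap_edge (hooked_mirror h) ir' al).
- by exists c; case: (hooked_swap_edge h ir al).
Qed.

(** * Reduction to a canonical cycle *)

Definition paired n i (f g : nat -> nat) :=
  (f i == n.-1 - i) || (g i == n.-1 - i).

(** The weight makes it profitable to trade a pair at level i+1 for one at level i; a pair at level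
    0 costs nothing. *)
Definition potential n r f g := \sum_(i < r) paired n i f g * i.

Lemma paired_sym n i f g : paired n i f g = paired n i g f.
Proof. exact: orbC. Qed.

Lemma potential_sym n r f g : potential n r f g = potential n r g f.
Proof. by apply: eq_bigr => i _; rewrite paired_sym. Qed.

Lemma eq_potential n r f g f' g' :
  (forall x, x < r -> paired n x f g = paired n x f' g') ->
  potential n r f g = potential n r f' g'.
Proof. by move=> e; apply: eq_bigr => i _; rewrite e. Qed.

Lemma sum_lt_two r i (F G : nat -> nat) : i.+1 < r ->
  (forall x, x < r -> x != i -> x != i.+1 -> F x = G x) ->
  F i + F i.+1 < G i + G i.+1 ->
  \sum_(x < r) F x < \sum_(x < r) G x.
Proof.
move=> ir e lt; have ir' := ltnW ir.
have split2 (H : nat -> nat) : \sum_(x < r) H x =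
    H i + H i.+1 + \sum_(x < r | (val x != i) && (val x != i.+1)) H x.
  rewrite (bigD1 (Ordinal ir')) //= (bigD1 (Ordinal ir)) /= ?addnA //.
  by rewrite -val_eqE /=; lia.
rewrite !split2 -addSn leq_add //; apply: eq_leq; apply: eq_bigr => x /andP[xi xi1].
exact: e.
Qed.

Lemma paired_swap n i x f g : x != i -> x != i.+1 -> n.-1 - x != i ->
  n.-1 - x != i.+1 ->
  paired n x (conjf (swap i) f) (conjf (swap i) g) = paired n x f g.
Proof.
move=> xi xi1 yi yi1; rewrite /paired /conjf.
have E u : (swap i (u (swap i x)) == n.-1 - x) = (u x == n.-1 - x).
  have -> : swap i x = x by case: (swapP i x) => -[]; lia.
  by case: (swapP i (u x)) => -[]; lia.
by rewrite !E.
Qed.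

Lemma paired_mirror n r c f g x : hooked n r c f g -> x < r ->
  paired n x (conjf (mirror n) f) (conjf (mirror n) g) = paired n x f g.
Proof.
move=> h xr; have nP := hooked_n h; rewrite /paired /conjf orbC.
have mx : mirror n x = n.-1 - x by have := mirrorP n x; lia.
have E u v : hooked n r c u v ->
    (mirror n (u (mirror n x)) == n.-1 - x) = (v x == n.-1 - x).
  move=> hu; rewrite -mx (can_eq (@mirrorK n)) -{2}(hooked_fK (hooked_sym hu) x).
  by rewrite (can_eq (hooked_fK hu)) eq_sym -(can_eq (hooked_fK hu)) (hooked_gK hu) eq_sym.
by rewrite (E _ _ h) (E _ _ (hooked_sym h)).
Qed.

(** If j and j* were both attached to the inner window, with [f j] equal to j*, then the cycle would
    run j, j*, the inner arc and back to j, so [j, j*] would be closed and miss 0. *)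
Lemma paired_level n r c f g j : hooked n r c f g -> 0 < j < r ->
  paired n j f g ->
  ~~ window n j.+1 (f j) && ~~ window n j.+1 (g j) ||
  ~~ window n j.+1 (f (n.-1 - j)) && ~~ window n j.+1 (g (n.-1 - j)).
Proof.
wlog fj : f g / f j = n.-1 - j.
  move=> W h jr pj; case/orP: (pj) => /eqP e; first exact: W.
  rewrite andbC [X in _ || X]andbC; apply: (W g f e) => //; first exact: hooked_sym.
  by rewrite paired_sym.
move=> h jr _; have nP := hooked_n h; have cP := hooked_c h.
rewrite -!negb_or -negb_and; apply/negP => /andP[].
have gj : g (n.-1 - j) = j by rewrite -fj (hooked_fK h).
rewrite fj gj.
have -> : window n j.+1 (n.-1 - j) = false by rewrite /window; lia.
have -> : window n j.+1 j = false by rewrite /window; lia.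
rewrite orbF /= => wg wf.
have [||||z wz wfz] := @hooked_conn _ _ _ _ _ h (window n j) c 0.
- by rewrite /window; clear -nP jr cP; lia.
- by rewrite /window; clear -jr; lia.
- by rewrite (hooked_supp h) eqxx !orbT.
- by rewrite (hooked_supp h); clear -jr; lia.
have wS x : window n j.+1 x -> window n j x by rewrite /window; clear; lia.
have zj : z != j.
  by apply: contraNneq wfz => ->; rewrite fj /window; clear -nP jr; lia.
have zj' : z != n.-1 - j by apply: contraNneq wfz => ->; apply: wS.
have wz1 : window n j.+1 z by move: wz; rewrite /window; clear -zj zj'; lia.
have wfz1 : ~~ window n j.+1 (f z) by apply: contraNN wfz; apply: wS.
have wj : ~~ window n j.+1 (f (g j)) by rewrite (hooked_gK h) /window; clear; lia.
have zE := hooked_exit h wz1 wg wfz1 wj.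
by move: wfz; rewrite zE (hooked_gK h) /window; clear -jr nP; lia.
Qed.

(** Let a = i+1 and let a be followed by a*. The window [a, a*] is entered at a from beyond a*, so
    by [adjacent_low] i is attached at its exit: [g i] lies inside and [f i] beyond. Hence
    [f i > f i.+1] and [g i < g i.+1]. After the swap level a is unpaired, level i contributes at
    most i, and the other levels are unchanged. *)
Lemma descend_low n r c i f g : hooked n r c f g -> i.+1 < r ->
  paired n i.+1 f g -> (i == 0) || ~~ paired n i f g ->
  ~~ window n i.+2 (f i.+1) -> ~~ window n i.+2 (g i.+1) ->
  mixed_swap i f g /\
  potential n r (conjf (swap i) f) (conjf (swap i) g) < potential n r f g.
Proof.
wlog fa : f g / f i.+1 = n.-1 - i.+1.
  move=> W h ir p1 p0 Nf Ng; case/orP: (p1) => /eqP e; first exact: W.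
  rewrite mixed_swapC potential_sym [ltnRHS]potential_sym.
  apply: (W g f) => //; rewrite 1?paired_sym //; exact: hooked_sym.
move=> h ir p1 p0 _ Ng; have nP := hooked_n h; have cP := hooked_c h.
have h' := hooked_sym h.
have fa0 : f i.+1 != i.+1 by rewrite (hooked_supp h) ir.
have gn : g i.+1 != n.-1 - i.+1.
  by apply/eqP => e; move: (hooked_neq2 h fa0); rewrite fa -e (hooked_gK h) eqxx.
have ga : n - i.+1 <= g i.+1 < n.
  by have := hooked_low h' ir; move: Ng gn; rewrite /window; clear -nP cP ir; lia.
have wa : window n i.+1 i.+1 by rewrite /window; clear -nP ir; lia.
have wi : ~~ window n i.+1 i by rewrite /window; clear; lia.
have wga : ~~ window n i.+1 (g i.+1) by rewrite /window; clear -ga; lia.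
have fi := hooked_low h (ltnW ir); have gi := hooked_low h' (ltnW ir).
have Nfi : ~~ window n i.+1 (f i).
  apply/negP => wf; have := hooked_entry h wf wa.
  by rewrite (hooked_fK h) => /(_ wi wga); clear -fi ir cP nP; lia.
have wgi : window n i.+1 (g i).
  have := adjacent_low h (ltnW ir); rewrite (negPf Nfi); apply.
  by move: p0; rewrite orbC /paired negb_or.
have {}fi : n - i.+1 <= f i by move: Nfi; rewrite /window; clear -fi ir cP nP; lia.
(* Otherwise the cycle reads a, a*, i, with a entered from outside, and an exit of the inner window
   is a second exit of [a, a*]. *)
have gia' : g i != n.-1 - i.+1.
  apply/eqP => gia; have fa' : f (n.-1 - i.+1) = i by rewrite -gia (hooked_gK h).
  have [||||z wz wfz] := @hooked_conn _ _ _ _ _ h (window n i.+2) c i.+1.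
  - by rewrite /window; clear -nP ir cP; lia.
  - by rewrite /window; clear; lia.
  - by rewrite (hooked_supp h) eqxx !orbT.
  - by rewrite (hooked_supp h) ir.
  have wz1 : window n i.+1 z by move: wz; rewrite /window; clear; lia.
  have fza : f z != i.+1.
    by apply: contraTneq wz => e; rewrite -[z](hooked_fK h) e /window; clear -ga; lia.
  have fza' : f z != n.-1 - i.+1.
    apply: contraTneq wz => e.
    by rewrite -[z](hooked_fK h) e -fa (hooked_fK h) /window; clear; lia.
  have wfz1 : ~~ window n i.+1 (f z).
    by move: wfz; rewrite /window; clear -fza fza'; lia.
  have wa' : window n i.+1 (n.-1 - i.+1) by rewrite /window; clear -nP ir; lia.
  have := hooked_exit h wz1 wa' wfz1; rewrite fa' => /(_ wi).
  by move: wz; rewrite /window; clear; lia.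
split.
  by rewrite /mixed_swap fa; move: wgi; rewrite /window; clear -fi ga nP ir; lia.
apply: (@sum_lt_two r i (fun x => paired n x _ _ * x) (fun x => paired n x f g * x)) => //.
  by move=> x xr xi xi1; rewrite paired_swap //; clear -xr nP ir; lia.
rewrite p1.
have -> : paired n i.+1 (conjf (swap i) f) (conjf (swap i) g) = false.
  have si : swap i i.+1 = i by case: (swapP i i.+1) => -[]; clear; lia.
  rewrite /paired /conjf si.
  have -> : swap i (f i) = f i by case: (swapP i (f i)) => -[]; clear -fi nP ir; lia.
  have -> : swap i (g i) = g i by case: (swapP i (g i)) => -[]; clear -gi cP nP ir; lia.
  by rewrite (negPf gia'); clear -fi nP ir; lia.
by case: (paired n i _ _); clear; lia.
Qed.

Lemma descend_high n r c i f g : hooked n r c f g -> i.+1 < r ->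
  paired n i.+1 f g -> (i == 0) || ~~ paired n i f g ->
  ~~ window n i.+2 (f (n.-1 - i.+1)) -> ~~ window n i.+2 (g (n.-1 - i.+1)) ->
  mixed_swap (n.-2 - i) f g /\
  potential n r (conjf (swap (n.-2 - i)) f) (conjf (swap (n.-2 - i)) g)
    < potential n r f g.
Proof.
move=> h ir p1 p0 Nf Ng; have nP := hooked_n h; have hm := hooked_mirror h.
have ma : mirror n i.+1 = n.-1 - i.+1.
  by have := mirrorP n i.+1; clear -ir nP; lia.
have ilt : (n.-2 - i).+1 < n by clear -ir nP; lia.
have iE : n.-2 - (n.-2 - i) = i by clear -ir nP; lia.
have [||||al lt] := descend_low hm ir.
- by rewrite (paired_mirror h).
- by rewrite (paired_mirror h (ltnW ir)).
- by rewrite /conjf window_mirror ma.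
- by rewrite /conjf window_mirror ma.
have hs := hooked_swap_low hm ir al.
split; first by rewrite -(mixed_swap_mirror h ilt) iE.
move: lt; rewrite (eq_potential (fun x => @paired_mirror _ _ _ _ _ x h)).
rewrite -(eq_potential (fun x => @paired_mirror _ _ _ _ _ x hs)).
congr (_ < _); apply: eq_potential => x _; rewrite /paired.
by have E u := conjf_mirror_swap u ilt; rewrite iE in E; rewrite !E.
Qed.

(** * Existence and uniqueness of the canonical cycle *)

Definition canonical n r f g :=
  [/\ hooked n r r f g, oriented n r f g
    & forall j, 0 < j < r -> ~~ paired n j f g].

(** While r < c, the fixed label c-1 is swapped with c; this is mixed because [f c] is small and
    [g c] large. Once c = r, the least positive paired level is handled by [descend_low] or
    [descend_high]. *)
Lemma progress n r c f g : hooked n r c f g -> oriented n r f g ->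
  canonical n r f g \/
  exists i c', [/\ i.+1 < n, mixed_swap i f g,
    hooked n r c' (conjf (swap i) f) (conjf (swap i) g),
    oriented n r (conjf (swap i) f) (conjf (swap i) g)
  & potential n r (conjf (swap i) f) (conjf (swap i) g) + c'
      < potential n r f g + c].
Proof.
move=> h o; have nP := hooked_n h; have cP := hooked_c h.
have [cr|cr] := ltnP r c.
  right; have [fc gc] := oriented_low_mid h o.
  have fi : f c.-1 = c.-1.
    by apply/eqP; rewrite -[_ == _]negbK (hooked_supp h); clear -cr cP; lia.
  have gi : g c.-1 = c.-1 by rewrite -{1}fi (hooked_fK h).
  have cE : c.-1.+1 = c by clear -cr; lia.
  have sc : swap c.-1 c = c.-1 by case: (swapP c.-1 c) => -[]; clear -cr; lia.
  exists c.-1, c.-1; split.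
  - by clear -cr cP; lia.
  - by rewrite /mixed_swap fi gi cE; clear -fc gc cr cP; lia.
  - by rewrite -{1}sc; apply: hooked_swap_mid => //; clear -cr cP; lia.
  - by apply: oriented_swap => //; clear -cr cP; lia.
  rewrite (eq_potential (f' := f) (g' := g)); first by rewrite ltn_add2l; clear -cr; lia.
  by move=> x xr; rewrite paired_swap //; clear -xr cr cP; lia.
have {cr} cr : c = r by clear -cr cP; lia.
pose P j := [&& 0 < j, j < r & paired n j f g].
have [ex|nex] := boolP (has P (iota 0 r)); last first.
  left; split=> //; first by rewrite -{2}cr.
  move=> j jr; apply: contraNN nex => pj; apply/hasP; exists j.
    by rewrite mem_iota; case/andP: jr.
  by rewrite /P pj andbT.
have exP : exists j, P j by case/hasP: ex => j _ Pj; exists j.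
case: (ex_minnP exP) => -[|i] /and3P[// _ ir p1] min.
have p0 : (i == 0) || ~~ paired n i f g.
  rewrite -implyNb; apply/implyP => i0; apply/negP => p0.
  by have := min i; rewrite /P p0 lt0n i0 (ltnW ir) => /(_ isT); clear; lia.
right; have := paired_level h _ p1; rewrite ir => /(_ isT) /orP[]/andP[Nf Ng].
  have [al lt] := descend_low h ir p1 p0 Nf Ng.
  exists i, c; split=> //; last by rewrite ltn_add2r.
  - by clear -nP ir; lia.
  - exact: hooked_swap_low.
  - by apply: oriented_swap => //; clear -nP ir; lia.
have [al lt] := descend_high h ir p1 p0 Nf Ng.
exists (n.-2 - i), c; split=> //; last by rewrite ltn_add2r.
- by clear -nP ir; lia.
- by apply: hooked_swap_high => //; clear -nP ir; lia.
- by apply: oriented_swap => //; clear -nP ir; lia.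
Qed.

(** By [adjacent_low], r-1 is attached to the window [r, r*], whose only moved label is r. As [f]
    sends r-1 to a large label, the attachment is [g r.-1 = r]. *)
Lemma canonical_flip n r f g : canonical n r f g ->
  [/\ mixed_swap r.-1 f g,
      hooked n r r (conjf (swap r.-1) f) (conjf (swap r.-1) g)
    & oriented n r (conjf (swap r.-1) g) (conjf (swap r.-1) f)].
Proof.
case=> h o np; have r0 := hooked_r h; have nP := hooked_n h.
have rE : r.-1.+1 = r by rewrite prednK.
have rr : r.-1 < r by rewrite rE.
have [fc gc] := oriented_low_mid h o.
have fi := o.1 _ rr; have gi := hooked_low (hooked_sym h) rr.
have gir : g r.-1 = r.
  apply/eqP; have := adjacent_low h rr; rewrite rE.
  have -> : window n r (f r.-1) = false by rewrite /window; clear -fi; lia.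
  have H : (f r.-1 != n.-1 - r.-1) && (g r.-1 != n.-1 - r.-1) || (r.-1 == 0).
    have [r1|r1] := eqVneq r.-1 0; first by rewrite orbT.
    by rewrite orbF -negb_or; apply: np; rewrite rr lt0n r1.
  by move/(_ H); rewrite /window; clear -gi nP; lia.
have al : mixed_swap r.-1 f g.
  by rewrite /mixed_swap rE gir -{2}gir (hooked_gK h); clear -fi gc nP r0; lia.
have [_ hs] := hooked_swap_edge h rE al; split=> //.
exact: oriented_swap_edge h rE erefl al o.
Qed.

(** Here y and x are the first and last labels of the inner arc. Both i and i* are attached to it,
    and only the places [f x] and [g y] are available; the orientation decides which is which. *)
Lemma canonical_ends n r f g i x y : canonical n r f g -> i < r ->
  window n i.+1 x -> window n i.+1 y ->
  ~~ window n i.+1 (f x) -> ~~ window n i.+1 (g y) ->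
  (f x, g y) = if x < r then (n.-1 - i, i) else (i, n.-1 - i).
Proof.
case=> h o np ir wx wy Nfx Ngy; have nP := hooked_n h.
have H : (f i != n.-1 - i) && (g i != n.-1 - i) || (i == 0).
  have [->|i0] := eqVneq i 0; first by rewrite orbT.
  by rewrite orbF -negb_or; apply: np; rewrite ir lt0n i0.
have E z : ~~ window n i.+1 z -> window n i.+1 (f z) || window n i.+1 (g z) ->
    g y = z \/ f x = z.
  move=> Nz /orP[w|w]; [left | right].
    by rewrite (hooked_entry h wy w Ngy) (hooked_fK h).
  by rewrite (hooked_exit h wx w Nfx) (hooked_gK h).
have Ni : ~~ window n i.+1 i by rewrite /window; clear; lia.
have Ni' : ~~ window n i.+1 (n.-1 - i) by rewrite /window; clear -nP ir; lia.
have e1 := E _ Ni (adjacent_low h ir H).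
have e2 := E _ Ni' (adjacent_high h ir H).
have [xr|xr] := ltnP x r.
  have fx := o.1 _ xr; have e3 : f x = n.-1 - i by clear -e1 e2 fx ir nP; lia.
  by congr (_, _) => //; clear -e1 e3 fx ir nP; lia.
have fxr : f x < r.
  have fx0 : f x != x by apply: contraNneq Nfx => ->.
  have [fc _] := oriented_low_mid h o.
  move: fx0; rewrite (hooked_supp h) (leq_gtF xr) /= => /orP[xh|/eqP -> //].
  case/orP: (hooked_high h xh) => // /eqP fxr.
  by move: Nfx; rewrite fxr /window; clear -nP ir; lia.
have e3 : f x = i by clear -e1 e2 fxr ir nP; lia.
by congr (_, _) => //; clear -e2 e3 fxr ir nP; lia.
Qed.

(** The arc grows by one label at each end. The new ends are i and i*, which are not adjacent, and
    they cannot lead back into the inner arc, whose only entry and exit are used; so the next labels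
    lie outside [i, i*]. *)
Lemma canonical_extend n r f g i x y : canonical n r f g -> 0 < i < r ->
  window n i.+1 x -> window n i.+1 y ->
  ~~ window n i.+1 (f x) -> ~~ window n i.+1 (g y) ->
  ~~ window n i (f (f x)) /\ ~~ window n i (g (g y)).
Proof.
move=> can /andP[i0 ir] wx wy Nfx Ngy; have [h o np] := can.
have nP := hooked_n h; have ii : i != n.-1 - i by clear -nP ir; lia.
have := np i; rewrite i0 ir => /(_ isT); rewrite negb_or => /andP[p1 p2].
have [p3 p4] : f (n.-1 - i) != i /\ g (n.-1 - i) != i.
  split; [apply: contraNneq p2 => e | apply: contraNneq p1 => e].
    by rewrite -[in g _]e (hooked_fK h).
  by rewrite -[in f _]e (hooked_gK h).
have W z : z != i -> z != n.-1 - i -> ~~ window n i.+1 z -> ~~ window n i z.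
  by rewrite /window; clear; lia.
have xy : f x != g y.
  have := canonical_ends can ir wx wy Nfx Ngy.
  by case: ifP => _ [-> ->]; rewrite // eq_sym.
have Nffx : ~~ window n i.+1 (f (f x)).
  apply: contraNN xy => w; rewrite (hooked_entry h wy w Ngy) ?(hooked_fK h) //.
have Nggy : ~~ window n i.+1 (g (g y)).
  apply: contraNN xy => w; rewrite (hooked_exit h wx w Nfx) ?(hooked_gK h) //.
have fi0 : f i != i by rewrite (hooked_supp h) ir.
have gi0 : g i != i by rewrite (hooked_supp (hooked_sym h)) ir.
have hi : n - r <= n.-1 - i < n by clear -ir nP; lia.
have fi0' : f (n.-1 - i) != n.-1 - i by rewrite (hooked_supp h) hi orbT.
have gi0' : g (n.-1 - i) != n.-1 - i.
  by rewrite (hooked_supp (hooked_sym h)) hi orbT.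
have := canonical_ends can ir wx wy Nfx Ngy.
by move: Nffx Nggy; case: ifP => _ Nffx Nggy [fx gy]; rewrite fx gy in Nffx Nggy *;
  split; apply: W.
Qed.

Lemma canonical_uniq n r f g f' g' :
  canonical n r f g -> canonical n r f' g' -> f =1 f'.
Proof.
move=> can can'; have [h o np] := can; have [h' o' np'] := can'.
have nP := hooked_n h; have r0 := hooked_r h; have cP := hooked_c h.
have fixed u v z : hooked n r r u v -> r < z < n - r \/ n <= z -> u z = z.
  by move=> hu zP; apply/eqP; rewrite -[_ == _]negbK (hooked_supp hu); clear -zP nP; lia.
(* Induction from the innermost window outwards, with d = r-1-i: on the window both cycles have the
   same arc from y to x, so they agree except at x, whose image lies outside. *)
have key d i : d + i.+1 = r -> exists x y,
    [/\ window n i.+1 x /\ window n i.+1 y,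
        ~~ window n i.+1 (f x) /\ ~~ window n i.+1 (g y),
        ~~ window n i.+1 (f' x) /\ ~~ window n i.+1 (g' y)
      & forall z, window n i.+1 z -> z != x -> f z = f' z].
  elim: d i => [|d IH] i; rewrite ?add0n => ir.
    have E u v : hooked n r r u v -> ~~ window n r (u r).
      move=> hu; have ur : u r != r by rewrite (hooked_supp hu) eqxx !orbT.
      have uur : u (u r) != u r by rewrite (can_eq (hooked_fK hu)).
      rewrite (hooked_supp hu) (negPf ur) in uur.
      by rewrite /window; clear -ur uur nP; lia.
    have wr : window n r r by rewrite /window; clear -nP; lia.
    exists r, r; rewrite ir; split=> //;
      try by split;
        [apply: E; eassumption | apply: E; apply: hooked_sym; eassumption].
    move=> z wz zr; have zP : r < z < n - r \/ n <= z.
      by left; move: wz; rewrite /window; clear -zr; lia.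
    by rewrite (fixed _ _ _ h zP) (fixed _ _ _ h' zP).
  have [|x [y [[wx wy] [Nfx Ngy] [Nfx' Ngy'] ag]]] := IH i.+1; first by rewrite addnS.
  have ir' : i.+1 < r by rewrite -ir; clear; lia.
  have i0r : 0 < i.+1 < r by rewrite ir'.
  have [Ef Eg] := canonical_extend can i0r wx wy Nfx Ngy.
  have [Ef' Eg'] := canonical_extend can' i0r wx wy Nfx' Ngy'.
  have E := canonical_ends can ir' wx wy Nfx Ngy.
  have E' := canonical_ends can' ir' wx wy Nfx' Ngy'.
  (* The ends given by [canonical_ends] depend only on i and on whether x is small. *)
  have [fx gy] : f' x = f x /\ g' y = g y.
    by move: E'; rewrite -E => -[-> ->].
  have fxgy : (f x == i.+1) && (g y == n.-1 - i.+1)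
           || (f x == n.-1 - i.+1) && (g y == i.+1).
    by case: ifP E => _ [-> ->]; rewrite !eqxx ?orbT.
  rewrite fx gy in Ef' Eg'.
  exists (f x), (g y); split=> //.
    by rewrite /window; clear -fxgy ir' nP; lia.
  move=> z wz zfx; have [->|zx] := eqVneq z x; first by [].
  have [wz2|Nz2] := boolP (window n i.+2 z); first exact: ag.
  have -> : z = g y by move: wz Nz2; rewrite /window; clear -zfx fxgy ir' nP; lia.
  by rewrite (hooked_gK h) -gy (hooked_gK h').
have [|x [y [[wx wy] [Nfx Ngy] [Nfx' Ngy'] ag]]] := key r.-1 0.
  by rewrite addn1 prednK.
have E := canonical_ends can r0 wx wy Nfx Ngy.
have E' := canonical_ends can' r0 wx wy Nfx' Ngy'.
have [fx gy] : f' x = f x /\ g' y = g y by move: E'; rewrite -E => -[-> ->].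
have fxgy : (f x == 0) && (g y == n.-1 - 0) || (f x == n.-1 - 0) && (g y == 0).
  by case: ifP E => _ [-> ->]; rewrite !eqxx ?orbT.
(* Only 0 and n-1 remain: [f x] is neither fixed nor sent into [1, n-2], which is entered only at y,
   so it is sent to [g y]. *)
have closing u v : hooked n r r u v -> u x = f x -> v y = g y -> u (f x) = g y.
  move=> hu ux vy; have fxn : f x < n by clear -fxgy nP; lia.
  have un : u (f x) < n by apply: (hooked_ltn hu).
  have Nu : ~~ window n 1 (u (f x)).
    apply/negP => w; have e := hooked_entry hu w wy.
    rewrite vy (hooked_fK hu) in e; have {}e := e Nfx Ngy.
    have : f x = g y by rewrite -vy -e (hooked_fK hu).
    by clear -fxgy nP r0; lia.
  have unf : u (f x) != f x.
    rewrite (hooked_supp hu); clear -fxgy nP r0; lia.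
  by move: Nu; rewrite /window; clear -un unf fxgy; lia.
move=> z; have [zn|zn] := leqP n z.
  by rewrite (fixed _ _ z h) ?(fixed _ _ z h') //; right.
have [->|zx] := eqVneq z x; first by [].
have [wz2|Nz2] := boolP (window n 1 z); first exact: ag.
have [->|zfx] := eqVneq z (f x).
  by rewrite (closing f g) // (closing f' g').
have -> : z = g y by move: Nz2; rewrite /window; clear -zn zfx fxgy; lia.
by rewrite (hooked_gK h) -gy (hooked_gK h').
Qed.

(** * Coxeter length and conjugation *)

Definition nat_perm n (s : 'S_n) x := oapp (fun i : 'I_n => val (s i)) x (insub x).

Lemma nat_permE n (s : 'S_n) (i : 'I_n) : nat_perm s i = s i.
Proof. by rewrite /nat_perm valK. Qed.

Lemma nat_perm_out n (s : 'S_n) x : n <= x -> nat_perm s x = x.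
Proof. by move=> nx; rewrite /nat_perm insubN // -leqNgt. Qed.

Lemma nat_permK n (s : 'S_n) : cancel (nat_perm s) (nat_perm s^-1).
Proof.
move=> x; have [nx|xn] := leqP n x; first by rewrite !nat_perm_out.
by rewrite (nat_permE s (Ordinal xn)) nat_permE permK.
Qed.

Lemma nat_perm_inj n (s s' : 'S_n) : nat_perm s =1 nat_perm s' -> s = s'.
Proof. by move=> e; apply/permP => i; apply/val_inj; rewrite /= -!nat_permE. Qed.

Lemma val_tperm_succ n (i j x : 'I_n) : j = i.+1 :> nat ->
  tperm i j x = swap i x :> nat.
Proof.
move=> ij; case: tpermP => [->|->|/eqP xi /eqP xj]; rewrite /swap ?eqxx //.
  by rewrite ij -[i.+1 == i]negbK neq_ltn ltnSn orbT eqxx.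
by rewrite -val_eqE /= in xi; rewrite -val_eqE /= ij in xj; rewrite (negPf xi) (negPf xj).
Qed.

Lemma nat_perm_conj n (s : 'S_n) (i j : 'I_n) : j = i.+1 :> nat ->
  nat_perm (tperm i j * s * tperm i j) =1 conjf (swap i) (nat_perm s).
Proof.
move=> ij x; have [nx|xn] := leqP n x.
  have jn := ltn_ord j; have sx : swap i x = x.
    by case: (swapP i x) => -[]; lia.
  by rewrite /conjf nat_perm_out // sx nat_perm_out.
rewrite -[x]/(val (Ordinal xn)) nat_permE !permM /conjf val_tperm_succ //=.
by rewrite -(val_tperm_succ (Ordinal xn) ij) nat_permE.
Qed.

Lemma conj_tpermV n (s : 'S_n) i j :
  ((tperm i j * s * tperm i j)^-1 = tperm i j * s^-1 * tperm i j)%g.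
Proof. by rewrite !invMg tpermV mulgA. Qed.

Lemma coxeter_lengthV n (w : 'S_n) : coxeter_length w^-1 = coxeter_length w.
Proof.
pose phi (p : 'I_n * 'I_n) := (w p.2, w p.1).
have phi_inj : injective phi.
  by move=> [a b] [a' b'] [/perm_inj -> /perm_inj ->].
rewrite /coxeter_length -[LHS](card_preimset _ phi_inj).
by apply: eq_card => p; rewrite !inE /= !permK andbC.
Qed.

(** Applying the transposition to both entries of a pair matches the inversions of the two
    permutations away from (i, j); the summands avoid a subtraction. *)
Lemma coxeter_length_tperm n (w : 'S_n) (i j : 'I_n) : j = i.+1 :> nat ->
  coxeter_length (tperm i j * w) + (w j < w i) = coxeter_length w + (w i < w j).
Proof.
move=> ij; pose phi (p : 'I_n * 'I_n) := (tperm i j p.1, tperm i j p.2).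
have phi_inj : injective phi.
  by move=> [a b] [a' b'] [/perm_inj -> /perm_inj ->].
rewrite /coxeter_length (cardsD1 (i, j)) [in RHS](cardsD1 (i, j)).
rewrite -[X in _ = _ + X + _](card_preimset _ phi_inj).
rewrite !inE /= !permM tpermL tpermR ij ltnSn /=.
rewrite addnAC addnC [RHS]addnAC [RHS]addnC; congr (_ + _); last by rewrite addnC.
apply: eq_card => -[a b]; rewrite !inE /= !permM !andbA; congr (_ && _).
rewrite !xpair_eqE -!val_eqE /= !val_tperm_succ // ij.
by case: (swapP i a) => -[]; case: (swapP i b) => -[]; lia.
Qed.

Lemma conj_tperm_id n (w : 'S_n) (i j : 'I_n) :
  (w i == i) && (w j == j) || (w i == j) && (w j == i) ->
  (tperm i j * w * tperm i j = w)%g.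
Proof.
move=> e; rewrite [(tperm i j * w)%g]conjgC tpermJ; have -> : tperm (w i) (w j) = tperm i j.
  by case/orP: e => /andP[/eqP -> /eqP ->]; rewrite // tpermC.
by rewrite -mulgA tperm2 mulg1.
Qed.

(** Each of the two multiplications by the transposition changes the length by one, with a sign read
    off [w] for one side and off its inverse for the other. The signs cancel exactly in the mixed
    case, unless the conjugation is trivial. *)
Lemma coxeter_length_conj n (w : 'S_n) (i j : 'I_n) : j = i.+1 :> nat ->
  ((tperm i j * w * tperm i j)%g == w) ||
  (mixed_swap i (nat_perm w) (nat_perm w^-1)
     == (coxeter_length (tperm i j * w * tperm i j) == coxeter_length w)).
Proof.
move=> ij; set t := tperm i j.
have [e|ne] := boolP ((w i == i) && (w j == j) || (w i == j) && (w j == i)).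
  by rewrite conj_tperm_id // eqxx.
apply/orP; right.
have l1 := coxeter_length_tperm w ij; have l2 := coxeter_length_tperm (w^-1 * t)%g ij.
have e2 : coxeter_length (w^-1 * t)%g = coxeter_length (t * w)%g.
  by rewrite -coxeter_lengthV invMg invgK tpermV.
have e1 : coxeter_length (t * (w^-1 * t))%g = coxeter_length (t * w * t)%g.
  by rewrite -coxeter_lengthV mulgA /t conj_tpermV invgK.
rewrite e1 e2 !permM !val_tperm_succ // in l2.
rewrite /mixed_swap -ij !nat_permE.
have wij : w i != w j by rewrite (inj_eq perm_inj) -val_eqE /= ij; lia.
have vij : (w^-1)%g i != (w^-1)%g j by rewrite (inj_eq perm_inj) -val_eqE /= ij; lia.
(* The swap preserves the order of two distinct values unless these are i and i+1, a case already
   excluded by [ne]. *)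
have E : (swap i ((w^-1)%g i) < swap i ((w^-1)%g j)) = ((w^-1)%g i < (w^-1)%g j).
  have ne' : ~~ (((w^-1)%g i == i) && ((w^-1)%g j == j)
              || ((w^-1)%g i == j) && ((w^-1)%g j == i)).
    apply: contraNN ne => /orP[]/andP[/eqP/(canRL (permKV w)) e3 /eqP/(canRL (permKV w)) e4];
      by rewrite -e3 -e4 !eqxx ?orbT.
  move: ne' vij; rewrite -!val_eqE /= ij.
  by case: (swapP i ((w^-1)%g i)) => -[]; case: (swapP i ((w^-1)%g j)) => -[]; clear; lia.
have E' : (swap i ((w^-1)%g j) < swap i ((w^-1)%g i)) = ((w^-1)%g j < (w^-1)%g i).
  move: E vij; rewrite -!val_eqE /=.
  have := inj_eq (can_inj (@swapK i)) ((w^-1)%g i) ((w^-1)%g j); clear; lia.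
rewrite E E' in l2; move: wij vij l1 l2; rewrite -/t -!val_eqE /=; clear.
case: (ltngtP (w i) (w j)) => //; case: (ltngtP ((w^-1)%g i) ((w^-1)%g j)) => //=; lia.
Qed.

Lemma conj_equiv_refl n : reflexive (@conj_equiv n).
Proof. by move=> w; rewrite /conj_equiv /conj_le connect0. Qed.

Lemma conj_equiv_sym n : symmetric (@conj_equiv n).
Proof. by move=> w w'; rewrite /conj_equiv andbC. Qed.

Lemma conj_equiv_trans n : transitive (@conj_equiv n).
Proof.
move=> w2 w1 w3 /andP[a b] /andP[c d]; rewrite /conj_equiv /conj_le.
by rewrite (connect_trans a c) (connect_trans d b).
Qed.

Lemma conj_equiv_step n (w : 'S_n) (i j : 'I_n) : j = i.+1 :> nat ->
  mixed_swap i (nat_perm w) (nat_perm w^-1) ->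
  conj_equiv w (tperm i j * w * tperm i j)%g.
Proof.
move=> ij m; have := coxeter_length_conj w ij; rewrite m.
case/orP => [/eqP ->|/eqP/esym/eqP e]; first exact: conj_equiv_refl.
apply/andP; split; apply: connect1; apply/existsP; exists i; apply/existsP; exists j;
  rewrite ij eqxx e leqnn andbT //=.
by rewrite !mulgA tperm2 mul1g -mulgA tperm2 mulg1.
Qed.

Lemma conj_equivV n (w w' : 'S_n) : conj_equiv w w' -> conj_equiv w^-1%g w'^-1%g.
Proof.
have V (u v : 'S_n) : conj_le u v -> conj_le u^-1%g v^-1%g.
  case/connectP => p; elim: p u => [|x p IH] u /=; first by move=> _ ->; apply: connect0.
  case/andP => /existsP[i /existsP[j /and3P[ij /eqP xE len]]] px vE.
  apply: connect_trans (IH x px vE); apply: connect1; apply/existsP; exists i.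
  apply/existsP; exists j.
  by rewrite ij xE conj_tpermV eqxx !coxeter_lengthV -conj_tpermV coxeter_lengthV -xE.
by case/andP => a b; apply/andP; split; apply: V.
Qed.

(** * Equivalence classes of hooked permutations *)

Definition hooked_perm n r c (s : 'S_n) := hooked n r c (nat_perm s) (nat_perm s^-1).

Lemma hooked_permV n r c (s : 'S_n) : hooked_perm r c s -> hooked_perm r c s^-1.
Proof. by rewrite /hooked_perm invgK => /hooked_sym. Qed.

Lemma hooked_perm_conj n r c (s : 'S_n) (i j : 'I_n) : j = i.+1 :> nat ->
  hooked n r c (conjf (swap i) (nat_perm s)) (conjf (swap i) (nat_perm s^-1)) ->
  hooked_perm r c (tperm i j * s * tperm i j)%g.
Proof.
by move=> ij; apply: hooked_ext => x; rewrite ?conj_tpermV nat_perm_conj.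
Qed.

(** Lengths increase neither along the path to [s'] nor on the way back, so every step preserves the
    length and is trivial or mixed. *)
Lemma hooked_perm_equiv n r c (s s' : 'S_n) : conj_equiv s s' ->
  hooked_perm r c s -> exists c', hooked_perm r c' s'.
Proof.
case/andP=> /connectP[p]; elim: p s c => [|x p IH] s c /=.
  by move=> _ -> _ hs; exists c.
case/andP => sx px s'E s's hs.
have le_len (u v : 'S_n) : conj_le u v -> coxeter_length v <= coxeter_length u.
  case/connectP => q; elim: q u => [|y q IHq] u /=; first by move=> _ ->.
  case/andP => /existsP[i /existsP[j /and3P[_ _ len]]] qy vE.
  exact: leq_trans (IHq y qy vE) len.
have xs : conj_le x s by apply: connect_trans s's; apply/connectP; exists p.
have [c' hx] : exists c', hooked_perm r c' x.
  case/existsP: (sx) => i /existsP[j /and3P[/eqP ij /eqP xE len]].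
  have /eqP len' : coxeter_length x == coxeter_length s.
    by rewrite eqn_leq len le_len.
  have := coxeter_length_conj s ij; rewrite -xE len' eqxx => /orP[/eqP ->|/eqP m].
    by exists c.
  have [|c' h] := hooked_swap hs _ m; first by rewrite -ij.
  by exists c'; rewrite xE; apply: hooked_perm_conj.
apply: (IH x c') => //; apply: connect_trans s's _; exact: connect1.
Qed.

Definition oriented_perm n r (s : 'S_n) := oriented n r (nat_perm s) (nat_perm s^-1).

Definition canonical_perm n r (s : 'S_n) := canonical n r (nat_perm s) (nat_perm s^-1).

Lemma conj_equiv_canonical n r c (s : 'S_n) :
  hooked_perm r c s -> oriented_perm r s ->
  exists2 s', conj_equiv s s' & canonical_perm r s'.
Proof.
have [m] := ubnP (potential n r (nat_perm s) (nat_perm s^-1) + c).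
elim: m s c => // m IH s c le hs os.
have [can|[i [c' [ilt mix hs' os' lt]]]] := progress hs os.
  by exists s => //; apply: conj_equiv_refl.
pose i' := Ordinal (ltnW ilt); pose j' := Ordinal ilt.
have ij : j' = i'.+1 :> nat by [].
have e := nat_perm_conj s ij; have e' := nat_perm_conj s^-1 ij.
have [|||s' ss' cs'] := IH (tperm i' j' * s * tperm i' j')%g c'.
- rewrite -ltnS; apply: leq_trans le; rewrite conj_tpermV !ltnS; apply: leq_trans lt.
  rewrite ltnS leq_add2r; apply: eq_leq; apply: eq_potential => x _.
  by rewrite /paired e e'.
- exact: hooked_perm_conj.
- by rewrite /oriented_perm conj_tpermV; apply: oriented_ext os' => x.
exists s' => //; apply: conj_equiv_trans ss'; exact: conj_equiv_step.
Qed.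

(** Equally oriented permutations reduce to the same canonical one, directly or after inversion. For
    opposite orientations, [canonical_flip] first reverses one of them. *)
Lemma conj_equiv_hooked n r c c' (s s' : 'S_n) :
  hooked_perm r c s -> hooked_perm r c' s' -> conj_equiv s s'.
Proof.
have same (u v : 'S_n) d d' : hooked_perm r d u -> hooked_perm r d' v ->
    oriented_perm r u -> oriented_perm r v -> conj_equiv u v.
  move=> hu hv ou ov; have [u' uu' cu] := conj_equiv_canonical hu ou.
  have [v' vv' cv] := conj_equiv_canonical hv ov.
  have E : u' = v' by apply: nat_perm_inj; apply: canonical_uniq cu cv.
  by apply: conj_equiv_trans uu' _; rewrite E conj_equiv_sym.
have sameV (u v : 'S_n) d d' : hooked_perm r d u -> hooked_perm r d' v ->
    oriented_perm r u^-1 -> oriented_perm r v^-1 -> conj_equiv u v.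
  move=> hu hv ou ov; rewrite -[u]invgK -[v]invgK; apply: conj_equivV.
  by apply: same ou ov; apply: hooked_permV; eassumption.
have mixed (u v : 'S_n) d d' : hooked_perm r d u -> hooked_perm r d' v ->
    oriented_perm r u -> oriented_perm r v^-1 -> conj_equiv u v.
  move=> hu hv ou ov; have [u' uu' cu] := conj_equiv_canonical hu ou.
  have [mix hw ow] := canonical_flip cu.
  have r0 := hooked_r hu; have nP := hooked_n hu.
  have ilt : r.-1.+1 < n by rewrite prednK //; clear -r0 nP; lia.
  pose i' := Ordinal (ltnW ilt); pose j' := Ordinal ilt.
  have ij : j' = i'.+1 :> nat by [].
  apply: conj_equiv_trans uu' _; apply: conj_equiv_trans (conj_equiv_step ij mix) _.
  apply: (sameV _ _ _ _ (hooked_perm_conj ij hw) hv _ ov).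
  rewrite /oriented_perm invgK conj_tpermV.
  by apply: oriented_ext ow => x; rewrite nat_perm_conj.
move=> hs hs'.
have osc (u : 'S_n) d : hooked_perm r d u -> oriented_perm r u \/ oriented_perm r u^-1.
  by move=> hu; rewrite /oriented_perm invgK; apply: hooked_osc hu.
case: (osc _ _ hs) (osc _ _ hs') => o [] o'.
- exact: (same _ _ _ _ hs hs' o o').
- exact: (mixed _ _ _ _ hs hs' o o').
- by rewrite conj_equiv_sym; exact: (mixed _ _ _ _ hs' hs o' o).
- exact: (sameV _ _ _ _ hs hs' o o').
Qed.

(** * Cycle standardization *)

Lemma cycle_permE (T : finType) (c : seq T) x : uniq c -> cycle_perm c x = next c x.
Proof. by move=> uc; rewrite permE undup_id. Qed.

Lemma mem_orbit_porbit (T : finType) (s : {perm T}) x y :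
  (y \in fingraph.orbit s x) = (y \in porbit s x).
Proof.
rewrite -fconnect_orbit; apply/idP/porbitP => [/iter_findex <-|[i ->]].
  by exists (findex s x y); rewrite permX.
by rewrite permX fconnect_iter.
Qed.

(** The witness sends each rank to the cycle label of that rank; through it, properties of the
    standardization are read off [s]. *)
Lemma cst_transport n k (c : k.-tuple 'I_n) (s : 'S_n) : uniq c ->
  (forall i, s (tnth c i) = next c (tnth c i)) ->
  exists h : 'I_k -> 'I_n, [/\ forall u v : 'I_k, u < v -> h u < h v,
    forall u, h (cst c u) = s (h u) & forall y, (y \in c) = (y \in codom h)].
Proof.
move=> uc sc; pose g i := Ordinal (cst_rank_subproof c i).
have rank_lt i j : tnth c i < tnth c j -> g i < g j.
  have rank_gt0 l : 0 < cst_rank c l.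
    by rewrite card_gt0; apply/set0Pn; exists l; rewrite inE.
  move=> ij; rewrite /= -ltnS !prednK //.
  apply: proper_card; apply/properP; split.
    by apply/subsetP => l; rewrite !inE => /leq_trans; apply; apply: ltnW.
  by exists j; rewrite !inE ?leqnn // -ltnNge.
have cinj : injective (tnth c) by apply/tuple_uniqP.
have ginj : injective g.
  move=> i j e; apply: cinj; apply/val_inj => /=.
  by case: (ltngtP (tnth c i) (tnth c j)) => // /rank_lt; rewrite e ltnn.
exists (fun u => tnth c (invF ginj u)); split.
- move=> u v; rewrite -{1}(f_invF ginj u) -{1}(f_invF ginj v).
  case: (ltngtP (tnth c (invF ginj u)) (tnth c (invF ginj v))) => //.
    by move=> /rank_lt lt /ltn_trans/(_ lt); rewrite ltnn.
  by move=> /val_inj/cinj ->; rewrite ltnn.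
- move=> u; rewrite -{1}(f_invF ginj u) /cst cycle_permE; last first.
    by rewrite map_inj_uniq ?enum_uniq.
  rewrite (next_map ginj (enum_uniq _)) invF_f sc -[in RHS](map_tnth_enum c).
  by rewrite (next_map cinj (enum_uniq _)).
- move=> y; apply/tnthP/codomP => -[i ->]; last by exists (invF ginj i).
  by exists (g i); rewrite invF_f.
Qed.

Lemma cst_at_transport n (s : 'S_n) x :
  exists h : 'I_(size (fingraph.orbit s x)) -> 'I_n,
  [/\ forall u v : 'I__, u < v -> h u < h v, forall u, h (cst_at s x u) = s (h u)
    & forall y, (y \in porbit s x) = (y \in codom h)].
Proof.
have uc : uniq (in_tuple (fingraph.orbit s x)) by exact: orbit_uniq.
have [|h [h1 h2 h3]] := cst_transport uc (s := s).
  move=> i; have := next_cycle (cycle_orbit (@perm_inj _ s) x) (mem_tnth i (in_tuple _)).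
  by move/eqP.
by exists h; split=> // y; rewrite -mem_orbit_porbit h3.
Qed.

(** An arc is left only at its last label and entered only at its first. Conversely, if the orbit of
    an entry point m left [M] too early, the rest of [M] would be closed under [t], since the only
    exit is used up. *)
Lemma connected_inP k (t : 'S_k) (M : {set 'I_k}) :
  (forall x y, y \in porbit t x) -> M != set0 ->
  connected_in t M <->
  {in M &, forall x y, t x \notin M -> t y \notin M -> x = y} /\
  {in M &, forall x y, (t^-1)%g x \notin M -> (t^-1)%g y \notin M -> x = y}.
Proof.
move=> trans M0; split=> [[m mM ME]|[ex _]].
  have inM i : i < #|M| -> (t ^+ i)%g m \in M.
    by move=> iM; rewrite ME; apply/imsetP; exists (Ordinal iM).
  have exM x : x \in M -> exists2 i, i < #|M| & x = (t ^+ i)%g m.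
    by rewrite {1}ME => /imsetP[i _ ->]; exists i.
  split=> x y /exM[i iM ->] /exM[j jM ->].
    have E l : l < #|M| -> t ((t ^+ l)%g m) \notin M -> l = #|M|.-1.
      move=> lM; apply: contraNeq => ll; rewrite -permM -expgSr; apply: inM.
      by rewrite ltn_neqAle lM andbT; apply: contraNneq ll => <-.
    by move=> /(E _ iM) -> /(E _ jM) ->.
  have E l : l < #|M| -> (t^-1)%g ((t ^+ l)%g m) \notin M -> l = 0.
    case: l => // l lM; rewrite expgSr permM permK inM //; exact: ltnW.
  by move=> /(E _ iM) -> /(E _ jM) ->.
(* Unless [M] is everything, m is found by walking backwards from a label of [M] until the preceding
   label is outside. *)
have [m mM entry] : exists2 m, m \in M & (t^-1)%g m \in M -> M = setT.
  have [MT|] := eqVneq M setT; first by have [m mM] := set0Pn _ M0; exists m.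
  rewrite -subTset => /subsetPn[y _ yM]; have [m0 m0M] := set0Pn _ M0.
  have /porbitP[i] := trans y m0; elim: i m0 m0M => [|i IH] m0 m0M e.
    by move: m0M yM; rewrite e expg0 perm1 => ->.
  have [pM|pM] := boolP ((t^-1)%g m0 \in M); last first.
    by exists m0 => // m0'; rewrite m0' in pM.
  by apply: (IH _ pM); rewrite e expgSr permM permK.
have inM i : i < #|M| -> (t ^+ i)%g m \in M.
  elim: i => [|i IH] iM; first by rewrite expg0 perm1.
  apply/negPn/negP => out; have {}IH := IH (ltnW iM).
  have inM : exists q, [&& 0 < q, q < #|M| & (t ^+ q)%g m \notin M].
    by exists i.+1; rewrite iM out.
  case: (ex_minnP inM) => q /and3P[q0 qM qout] min.
  have before l : l < q -> (t ^+ l)%g m \in M.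
    case: l => [|l] lq; first by rewrite expg0 perm1.
    apply/negPn/negP => lo; have := min l.+1.
    by rewrite lo (ltn_trans lq qM) => /(_ isT); rewrite leqNgt lq.
  (* [X] is the part of [M] visited before the first exit, at time q < |M|; the nonempty rest is
     stable, so its orbit never reaches m. *)
  pose X := [set (t ^+ (l : 'I_q))%g m | l in 'I_q].
  have XE l : l < q -> (t ^+ l)%g m \in X.
    by move=> lq; apply/imsetP; exists (Ordinal lq).
  have qE : t ((t ^+ q.-1)%g m) = (t ^+ q)%g m.
    by rewrite -permM -expgSr prednK.
  have q1 : q.-1 < q by rewrite prednK.
  have /subsetPn[y yM yX] : ~~ (M \subset X).
    apply: contraTN qM => /subset_leq_card; rewrite -leqNgt => /leq_trans; apply.
    by rewrite -[leqRHS]card_ord leq_imset_card.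
  have step z : (z \in M) && (z \notin X) -> (t z \in M) && (t z \notin X).
    move=> /andP[zM zX]; have tzM : t z \in M.
      apply: contraNT zX => tz; rewrite (ex z ((t ^+ q.-1)%g m)) ?XE ?before //.
      by rewrite qE.
    rewrite tzM /=; apply: contra zX => /imsetP[[[|l] lq] _ /= tz].
      move: tz; rewrite expg0 perm1 => tz; have: M = setT.
        by apply: entry; rewrite -tz permK.
      by move=> MT; move: qout; rewrite MT inE.
    have -> : z = (t ^+ l)%g m by apply: (@perm_inj _ t); rewrite tz expgSr permM.
    by apply: XE; apply: ltnW.
  have /porbitP[j mE] := trans y m.
  have iterE l : ((t ^+ l)%g y \in M) && ((t ^+ l)%g y \notin X).
    elim: l => [|l IHl]; first by rewrite expg0 perm1 yM yX.
    by rewrite expgSr permM; apply: step.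
  by have := iterE j; rewrite -mE => /andP[_]; rewrite -[m in m \notin _](perm1 m) -(expg0 t) XE.
exists m => //; apply/esym/eqP; rewrite eqEcard; apply/andP; split.
  by apply/subsetP => y /imsetP[i _ ->]; apply: inM.
rewrite card_in_imset ?card_ord // => i j _ _ /eqP e; apply/val_inj/eqP.
have oM l : l < #|M| -> l < #|porbit t m|.
  by move/leq_trans; apply; apply: subset_leq_card; apply/subsetP => y _; apply: trans.
rewrite -(nth_uniq m _ _ (uniq_traject_porbit t m)) ?size_traject ?oM ?ltn_ord //.
by move: e; rewrite !permX !nth_traject ?oM ?ltn_ord.
Qed.

Lemma porbit_fixed (T : finType) (s : {perm T}) x :
  (s x == x) = (#|porbit s x| == 1).
Proof.
apply/eqP/eqP => [sx|/eqP/cards1P[y e]].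
  apply/eqP/cards1P; exists x; apply/setP => y; rewrite inE; apply/porbitP/eqP.
    by case=> i ->; rewrite permX iter_fix.
  by move=> ->; exists 0; rewrite expg0 perm1.
have := mem_porbit s 1 x; have := mem_porbit s 0 x.
by rewrite e !inE expg0 expg1 perm1 => /eqP-> /eqP.
Qed.

Lemma porbits_porbit (T : finType) (s : {perm T}) C x :
  C \in porbits s -> x \in C -> C = porbit s x.
Proof. by case/imsetP => y _ -> xC; apply/eqP; rewrite eq_sym eq_porbit_mem. Qed.

(** The hook has exactly one part different from 1, so all moved points share one orbit. *)
Lemma hook_cycle n k (s : 'S_n) : 1 < k -> has_cycle_type s (hook n k) ->
  exists x0, #|porbit s x0| = k /\ forall y, (s y != y) = (y \in porbit s x0).
Proof.
move=> k1 ct; have: k \in [seq #|C| | C : {set 'I_n} <- enum (porbits s)].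
  by rewrite (perm_mem ct) inE eqxx.
case/mapP => C; rewrite mem_enum => /imsetP[x0 _ ->] ck.
exists x0; split=> // y; rewrite porbit_fixed.
have sz : size [seq D : {set 'I_n} <- enum (porbits s) | #|D| != 1] = 1.
  have := seq.permP ct (predC1 1); rewrite count_map -size_filter /= => ->.
  by rewrite count_nseq /= mul0n addn0 neq_ltn k1 orbT.
have fP D : (D \in [seq D : {set 'I_n} <- enum (porbits s) | #|D| != 1])
          = (#|D| != 1) && (D \in porbits s) by rewrite mem_filter mem_enum.
have x0F : porbit s x0 \in [seq D : {set 'I_n} <- enum (porbits s) | #|D| != 1].
  by rewrite fP imset_f // -ck neq_ltn k1 orbT.
have yP : (porbit s y \in [seq D : {set 'I_n} <- enum (porbits s) | #|D| != 1])
        = (#|porbit s y| != 1) by rewrite fP imset_f ?andbT.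
rewrite -yP; move: sz x0F; rewrite /=.
case: [seq D <- _ | _] => // D [|//] _; rewrite !inE => /eqP <-.
by rewrite eq_porbit_mem porbit_sym.
Qed.

(** An increasing map moves no label down, and a label skipped below r would be missing from its
    image. *)
Lemma mono_low n K r (h : 'I_K -> 'I_n) : (forall u v : 'I_K, u < v -> h u < h v) ->
  (forall i : 'I_n, i < r -> i \in codom h) ->
  forall u : 'I_K, u < r -> h u = u :> nat.
Proof.
move=> mono low.
have le m : forall u : 'I_K, val u = m -> m <= h u.
  elim: m => // m IH u um; have mK : m < K.
    by have := ltn_ord u; rewrite -[nat_of_ord u]/(val u) um => /ltnW.
  apply: leq_ltn_trans (IH (Ordinal mK) erefl) (mono _ _ _).
  by rewrite -[nat_of_ord u]/(val u) um.
suff eqm m : forall u : 'I_K, val u = m -> m < r -> h u = m :> nat.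
  by move=> u; apply: eqm.
have [M] := ubnP m; elim: M m => // M IH m mM u um mr.
have mn : m < n by apply: leq_ltn_trans (le m u um) (ltn_ord _).
have /codomP[v mv] := low (Ordinal mn) mr.
have hv : h v = m :> nat by rewrite -mv.
have := le _ v erefl; rewrite hv leq_eqVlt => /predU1P[vm|vm].
  by rewrite -hv; congr (val (h _)); apply/val_inj; rewrite um vm.
by have := IH v (leq_trans vm mM) v erefl (ltn_trans vm mr); rewrite hv => e; rewrite e ltnn in vm.
Qed.

Lemma mem_itv n a b (i : 'I_n) : (i \in itv n a b) = (a <= i.+1 <= b).
Proof. by rewrite inE. Qed.

Lemma mem_imset_perm (T : finType) (t : {perm T}) (A : {set T}) y :
  (y \in t @: A) = ((t^-1)%g y \in A).
Proof. by rewrite -[y in LHS](permKV t y) mem_imset //; apply: perm_inj. Qed.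

(** As K is odd, m is r or r+1; the second case, passed to complements, is the first for the
    inverse. *)
Lemma oscillating_cycleP K r (t : 'S_K) : K = r.*2.+1 -> 0 < r ->
  oscillating_cycle t <->
  oriented K r (nat_perm t) (nat_perm t^-1) \/
  oriented K r (nat_perm t^-1) (nat_perm t).
Proof.
move=> KE r0.
have imE m : t @: itv K 1 m = itv K (K - m + 1) K <->
    forall y : 'I_K, ((t^-1)%g y < m) = (K - m <= y).
  split=> [/setP e y|e].
    have := e y; rewrite mem_imset_perm !mem_itv; have := ltn_ord y; clear e; lia.
  by apply/setP => y; rewrite mem_imset_perm !mem_itv /= e; have := ltn_ord y; clear e; lia.
split.
  case=> m [m0 mK /imE e].
  have {mK} [mr|mr] : m = r \/ m = r.+1.
  - by move: mK; rewrite !inE KE /=; clear e; lia.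
  - subst m; left; split=> x xr.
      have xK : x < K by clear e; lia.
      rewrite (nat_permE t (Ordinal xK)) ltn_ord andbT -e permK; exact: xr.
    case/andP: xr => xr xK; rewrite (nat_permE t^-1 (Ordinal xK)) e; exact: xr.
  - subst m; right; split=> x xr.
      have xK : x < K by clear e; lia.
      rewrite (nat_permE t^-1 (Ordinal xK)) ltn_ord andbT.
      by have := e (Ordinal xK); rewrite /=; clear e; lia.
    case/andP: xr => xr xK; rewrite (nat_permE t (Ordinal xK)).
    by have := e (t (Ordinal xK)); rewrite permK /=; clear e; lia.
case=> -[o1 o2].
  exists r; split=> //; first by rewrite KE !inE eqxx.
  apply/imE => y; have yK := ltn_ord y; apply/idP/idP => H.
    have := o1 _ H; rewrite nat_permE permKV; clear; lia.
  by rewrite -nat_permE; apply: o2; rewrite H.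
exists r.+1; split=> //; first by rewrite KE !inE eqxx !orbT.
apply/imE => y; have yK := ltn_ord y; apply/idP/idP => H.
  apply/negPn/negP => yr; have := o1 y; rewrite nat_permE; clear o1 o2; lia.
apply/negPn/negP => yr; have := o2 ((t^-1)%g y); rewrite nat_permE permKV.
have := ltn_ord ((t^-1)%g y); clear o1 o2; lia.
Qed.

Lemma connected_intervalsP K (t : 'S_K) : (forall x y, y \in porbit t x) ->
  connected_intervals_cycle t <->
  forall a, a < K./2 ->
    unique_exit K a (nat_perm t) /\ unique_exit K a (nat_perm t^-1).
Proof.
move=> trans.
have wE a u : a < K./2 -> (u \in itv K a.+1 (K - a.+1 + 1)) = window K a u.
  by move=> aK; rewrite mem_itv /window; have := ltn_ord u; lia.
have uE (v : 'S_K) a : a < K./2 ->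
    {in itv K a.+1 (K - a.+1 + 1) &, forall x y,
      v x \notin itv K a.+1 (K - a.+1 + 1) ->
      v y \notin itv K a.+1 (K - a.+1 + 1) -> x = y} <->
    unique_exit K a (nat_perm v).
  move=> aK; split=> [ex x y wx wy|ex x y]; last first.
    rewrite !wE // => wx wy vx vy; apply/val_inj/ex; rewrite ?nat_permE //.
  have xK : x < K by move: wx; rewrite /window; clear; lia.
  have yK : y < K by move: wy; rewrite /window; clear; lia.
  rewrite (nat_permE v (Ordinal xK)) (nat_permE v (Ordinal yK)) => vx vy.
  by have := ex (Ordinal xK) (Ordinal yK); rewrite !wE // => /(_ wx wy vx vy)/(congr1 val).
have M0 a : a < K./2 -> itv K a.+1 (K - a.+1 + 1) != set0.
  move=> aK; have aK' : a < K by clear -aK; lia.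
  by apply/set0Pn; exists (Ordinal aK'); rewrite wE // /window /=; clear -aK; lia.
split=> [ci a aK|H j j0 jK].
  have [|e1 e2] := (connected_inP trans (M0 a aK)).1.
    by apply: ci => //; clear -aK; lia.
  by split; apply/uE.
case: j j0 jK => // a _ aK; have {}aK : a < K./2 by clear -aK; lia.
apply/(connected_inP trans (M0 a aK)); have [e1 e2] := H a aK.
by split; apply/uE.
Qed.

(** * Transport of the hook properties along the standardization *)

Section Transport.
Variables (n r K : nat) (h : 'I_K -> 'I_n).
Hypotheses (KE : K = r.*2.+1) (r0 : 0 < r).
Hypothesis mono : forall u v : 'I_K, u < v -> h u < h v.
Hypothesis ends : forall i : 'I_n, (i < r) || (n - r <= i) -> i \in codom h.

(** [mono_low] gives the small labels, its mirror image gives the large ones as a shift by n-K, and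
    monotonicity puts the image of r in between. *)
Lemma transport_values (u : 'I_K) : r.*2 < n /\
  (u < r /\ h u = u :> nat \/ u = r :> nat /\ r <= h u < n - r \/
   r < u /\ h u + K = n + u).
Proof.
have low : forall u : 'I_K, u < r -> h u = u :> nat.
  by apply: mono_low mono _ => i ir; apply: ends; rewrite ir.
have high (v : 'I_K) : r < v -> h v + K = n + v.
  move=> rv; have := @mono_low n K r (fun w => rev_ord (h (rev_ord w))) _ _ (rev_ord v).
  rewrite rev_ordK /=; have hv := ltn_ord (h v); have vK := ltn_ord v.
  move=> H; suff : n - (h v).+1 = K - v.+1 by clear H; lia.
  apply: H.
  - move=> w w' ww' /=; have := mono (u := rev_ord w') (v := rev_ord w).
    rewrite /=; have := ltn_ord w; have := ltn_ord w'.
    have := ltn_ord (h (rev_ord w)); have := ltn_ord (h (rev_ord w')).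
    by clear -ww'; lia.
  - move=> i ir; have /codomP[w e] : rev_ord i \in codom h.
      by apply: ends; rewrite /=; have := ltn_ord i; clear -ir; lia.
    by apply/codomP; exists (rev_ord w); rewrite rev_ordK -e rev_ordK.
  - by clear -rv KE vK; lia.
have uK := ltn_ord u; have hu := ltn_ord (h u).
have K1 : r.-1 < K by clear -KE; lia.
have K2 : r.+1 < K by clear -KE r0; lia.
have K3 : r < K by clear -KE r0; lia.
have l1 : h (Ordinal K1) = r.-1 :> nat by apply: low; rewrite /= prednK.
have l2 : h (Ordinal K2) + K = n + r.+1 by apply: high.
have l3 : h (Ordinal K1) < h (Ordinal K3) by apply: mono; rewrite /= prednK.
have l4 : h (Ordinal K3) < h (Ordinal K2) by apply: mono.
split; first by clear -l1 l2 l3 l4 KE r0; lia.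
case: (ltngtP u r) => ur.
- by left; split=> //; apply: low.
- by right; right; split=> //; apply: high.
have -> : u = Ordinal K3 by apply/val_inj.
by right; left; split=> //; clear -l1 l2 l3 l4 KE r0; lia.
Qed.

Lemma transport_window a (u : 'I_K) : a <= r -> window n a (h u) = window K a u.
Proof.
by move=> ar; have := transport_values u; have := ltn_ord u; rewrite /window; clear -KE ar; lia.
Qed.

Lemma transport_low (u : 'I_K) : (h u < r) = (u < r).
Proof. by have := transport_values u; have := ltn_ord u; clear -KE; lia. Qed.

Lemma transport_high (u : 'I_K) : (n - r <= h u) = (K - r <= u).
Proof. by have := transport_values u; have := ltn_ord u; clear -KE; lia. Qed.

Section Perm.
Variables (s : 'S_n) (t : 'S_K).
Hypothesis hts : forall u, h (t u) = s (h u).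

Lemma transport_permV u : h ((t^-1)%g u) = (s^-1)%g (h u).
Proof. by apply: (@perm_inj _ s); rewrite -hts !permKV. Qed.

Lemma oriented_transport :
  oriented K r (nat_perm t) (nat_perm t^-1) <->
  oriented n r (nat_perm s) (nat_perm s^-1).
Proof.
split=> -[o1 o2].
  split=> x xr.
    have xn : x < n.
      have K0 : 0 < K by rewrite KE.
      by have [nP _] := transport_values (Ordinal K0); clear -nP xr; lia.
    have /codomP[u xu] : Ordinal xn \in codom h by apply: ends; rewrite /= xr.
    rewrite (nat_permE s (Ordinal xn)) ltn_ord andbT xu -hts transport_high -nat_permE.
    by have := o1 u; rewrite -transport_low -xu => /(_ xr)/andP[].
  case/andP: xr => xr xn.
  have /codomP[u xu] : Ordinal xn \in codom h by apply: ends; rewrite /= xr orbT.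
  rewrite (nat_permE s^-1 (Ordinal xn)) xu -transport_permV transport_low -nat_permE.
  by apply: o2; rewrite ltn_ord andbT -transport_high -xu.
split=> x xr.
  have xK : x < K by clear -KE xr; lia.
  rewrite (nat_permE t (Ordinal xK)) ltn_ord andbT -transport_high hts -nat_permE.
  by have := o1 (h (Ordinal xK)); rewrite transport_low => /(_ xr)/andP[].
case/andP: xr => xr xK.
rewrite (nat_permE t^-1 (Ordinal xK)) -transport_low transport_permV -nat_permE.
by apply: o2; rewrite ltn_ord andbT transport_high.
Qed.

Lemma unique_exit_transport a : a < r -> (forall x, s x != x -> x \in codom h) ->
  unique_exit K a (nat_perm t) <-> unique_exit n a (nat_perm s).
Proof.
move=> ar supp; split=> ex x y wx wy.
  have xn : x < n by move: wx; rewrite /window; clear; lia.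
  have yn : y < n by move: wy; rewrite /window; clear; lia.
  rewrite (nat_permE s (Ordinal xn)) (nat_permE s (Ordinal yn)) => sx sy.
  have E z (zn : z < n) : window n a z -> ~~ window n a (s (Ordinal zn)) ->
      Ordinal zn \in codom h.
    by move=> wz sz; apply: supp; apply: contraNneq sz => ->.
  have /codomP[u xu] := E _ xn wx sx; have /codomP[v yv] := E _ yn wy sy.
  have wu : window K a u by rewrite -transport_window ?(ltnW ar) // -xu.
  have wv : window K a v by rewrite -transport_window ?(ltnW ar) // -yv.
  have uv : u = v.
    apply/val_inj/ex; rewrite // nat_permE -transport_window ?(ltnW ar) // hts.
      by rewrite -xu.
    by rewrite -yv.
  by have := congr1 val xu; rewrite /= uv -yv.
have xK : x < K by move: wx; rewrite /window; clear; lia.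
have yK : y < K by move: wy; rewrite /window; clear; lia.
rewrite (nat_permE t (Ordinal xK)) (nat_permE t (Ordinal yK)).
rewrite -!transport_window ?(ltnW ar) // !hts -!nat_permE => sx sy.
have : h (Ordinal xK) = h (Ordinal yK).
  by apply/val_inj/ex => //=; rewrite transport_window ?(ltnW ar).
case: (ltngtP x y) => // lt e.
  by have := mono (u := Ordinal xK) (v := Ordinal yK) lt; rewrite e ltnn.
by have := mono (u := Ordinal yK) (v := Ordinal xK) lt; rewrite e ltnn.
Qed.

End Perm.
End Transport.

Lemma cst_at_hook n r (s : 'S_n) x : 0 < r -> #|porbit s x| = r.*2.+1 ->
  (forall y, (s y != y) = (y \in porbit s x)) ->
  (forall i : 'I_n, (i < r) || (n - r <= i) -> s i != i) ->
  [/\ oscillating_cycle (cst_at s x) <->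
        oriented n r (nat_perm s) (nat_perm s^-1) \/
        oriented n r (nat_perm s^-1) (nat_perm s),
      connected_intervals_cycle (cst_at s x) <->
        forall a, a < r ->
          unique_exit n a (nat_perm s) /\ unique_exit n a (nat_perm s^-1)
    & exists2 c, r <= c < n - r & forall y, (nat_perm s y != y)
        = [|| y < r, n - r <= y < n | y == c]].
Proof.
move=> r0 card supp ends; have [h [mono hts cod]] := cst_at_transport s x.
(* The orbit size occurs in the type of the standardization, so it is generalized to a variable
   [K]. *)
move: (cst_at s x) hts => t hts; move: (size _) h mono cod t hts => K h mono cod t hts.
have hinj : injective h.
  move=> u v e; apply/val_inj; case: (ltngtP u v) => // /mono; by rewrite e ltnn.
have KE : K = r.*2.+1 by rewrite -card (eq_card cod) card_codom // card_ord.
have ends' (i : 'I_n) : (i < r) || (n - r <= i) -> i \in codom h.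
  by move=> /ends; rewrite supp cod.
have hts' u : h ((t^-1)%g u) = (s^-1)%g (h u) := transport_permV hts u.
have htsX i u : h ((t ^+ i)%g u) = (s ^+ i)%g (h u).
  by elim: i => [|i IH]; rewrite ?expg0 ?perm1 // !expgSr !permM hts IH.
have trans u v : v \in porbit t u.
  have hv w : h w \in porbit s x by rewrite cod codom_f.
  have : h v \in porbit s (h u) by rewrite (eqP (_ : porbit s (h u) == porbit s x)) ?eq_porbit_mem.
  by case/porbitP => i; rewrite -htsX => /hinj ->; apply: mem_porbit.
have ot := oriented_transport KE r0 mono ends' hts.
have ot' := oriented_transport KE r0 mono ends' hts'; rewrite !invgK in ot'.
have Kr : K./2 = r by clear -KE; lia.
split.
- have [o1 o2] := oscillating_cycleP t KE r0.
  split=> [/o1[/ot.1|/ot'.1]|[/ot.2|/ot'.2] o]; [by left | by right | |].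
    by apply: o2; left.
  by apply: o2; right.
- have ue a : a < r -> unique_exit K a (nat_perm t) /\ unique_exit K a (nat_perm t^-1)
      <-> unique_exit n a (nat_perm s) /\ unique_exit n a (nat_perm s^-1).
    move=> ar; have e1 := unique_exit_transport KE r0 mono ends' hts ar.
    have e2 := unique_exit_transport KE r0 mono ends' hts' ar.
    have [|i1 j1] := e1 _; first by move=> y; rewrite supp cod.
    have [|i2 j2] := e2 _.
      move=> y; rewrite -cod -supp; apply: contraNN => /eqP sy.
      by rewrite -{1}sy permK.
    by split=> -[a1 a2]; split; auto.
  have [c1 c2] := connected_intervalsP trans; rewrite Kr in c1 c2.
  split=> [/c1 H a ar|H]; first by apply/(ue a ar).1/H.
  by apply: c2 => a ar; apply/(ue a ar).2/H.
have rK : r < K by clear -KE; lia.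
have [nP] := transport_values KE r0 mono ends' (Ordinal rK).
move=> V; exists (h (Ordinal rK)); first by move: V; rewrite /=; clear; lia.
move=> y; have [ny|yn] := leqP n y.
  have -> : (nat_perm s y != y) = false by rewrite nat_perm_out // eqxx.
  by have := ltn_ord (h (Ordinal rK)); clear -ny nP; lia.
rewrite (nat_permE s (Ordinal yn)) -[_ != _]/(s (Ordinal yn) != Ordinal yn) supp cod.
apply/codomP/idP => [[u yu]|].
  have := transport_values KE r0 mono ends' u; have := congr1 val yu; rewrite /=.
  move=> -> [_ [[ur ->]|[[ur _]|[ur hu]]]]; first by rewrite ur.
    have -> : u = Ordinal rK by apply/val_inj.
    by rewrite eqxx !orbT.
  have := ltn_ord u; have := ltn_ord (h u); clear -ur hu KE; lia.
case: (y =P h (Ordinal rK)) => [yc _|_ H].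
  by exists (Ordinal rK); apply/val_inj.
by apply/codomP/ends' => /=; move: H; rewrite andbT orbF.
Qed.

Lemma trivial_cycle_hook K (t : 'S_K) : K = 1 ->
  oscillating_cycle t /\ connected_intervals_cycle t.
Proof.
move=> K1; subst K; split; last by case=> [|[|j]].
(* For k = 1 the only admissible m is (k+1)/2 = 1. *)
exists 1; split=> //; apply/setP => y.
by rewrite mem_imset_perm !mem_itv !ord1.
Qed.

Lemma size_orbit_porbit n (s : 'S_n) x :
  size (fingraph.orbit s x) = #|porbit s x|.
Proof.
by rewrite -(card_uniqP (orbit_uniq s x)); apply: eq_card => y; rewrite mem_orbit_porbit.
Qed.

Lemma porbit_conn n (s : 'S_n) x0 : (forall y, (s y != y) = (y \in porbit s x0)) ->
  forall (X : pred nat) x y, X x -> ~~ X y -> nat_perm s x != x ->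
    nat_perm s y != y -> exists2 z, X z & ~~ X (nat_perm s z).
Proof.
move=> supp X x y Xx Xy sx sy.
have lt z : nat_perm s z != z -> z < n.
  by case: (ltnP z n) => // nz; rewrite nat_perm_out ?eqxx.
have xn := lt _ sx; have yn := lt _ sy.
have [/existsP[z /andP[Xz Xsz]]|] := boolP [exists z : 'I_n, X z && ~~ X (s z)].
  by exists z; rewrite ?nat_permE.
rewrite negb_exists => /forallP closed.
have {closed} closed (z : 'I_n) : X z -> X (s z).
  by move=> Xz; have := closed z; rewrite Xz negbK.
have fx : s (Ordinal xn) != Ordinal xn by rewrite -val_eqE /= -nat_permE.
have fy : s (Ordinal yn) != Ordinal yn by rewrite -val_eqE /= -nat_permE.
have : Ordinal yn \in porbit s (Ordinal xn).
  rewrite supp -eq_porbit_mem in fx; rewrite (eqP fx) -supp; exact: fy.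
case/porbitP => i e; have {e} ye : y = (s ^+ i)%g (Ordinal xn) by rewrite -e.
case/negP: Xy; rewrite ye; elim: i {ye} => [|i IH]; first by rewrite expg0 perm1.
by rewrite expgSr permM; apply: closed.
Qed.

(** Fixed points satisfy the cycle conditions trivially. For the long cycle, condition (3) says that
    all small and large labels are moved, which is what transport along the standardization
    requires. *)
Lemma hook_propertiesP n r (s : 'S_n) : 0 < r ->
  has_cycle_type s (hook n r.*2.+1) ->
  hook_properties r.*2.+1 s <-> exists c, hooked_perm r c s.
Proof.
move=> r0 ct; have k1 : 1 < r.*2.+1 by clear -r0; lia.
have kr : (r.*2.+1)./2 = r by clear; lia.
have [x0 [card supp]] := hook_cycle k1 ct.
have same x : s x != x -> porbit s x = porbit s x0.
  by rewrite supp -eq_porbit_mem => /eqP.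
split.
  move=> [osc conn /(_ k1)[C [CP Ck inC]]].
  have {CP Ck} CE : C = porbit s x0.
    have /card_gt0P[y yC] : 0 < #|C| by rewrite Ck.
    rewrite (porbits_porbit CP yC); apply: same; rewrite porbit_fixed.
    by rewrite -(porbits_porbit CP yC) Ck; clear -r0; lia.
  have ends (i : 'I_n) : (i < r) || (n - r <= i) -> s i != i.
    rewrite supp -CE kr in inC *; case/orP => ir; first by case: (inC i); rewrite ?mem_itv.
    have ilt := ltn_ord i; rewrite -[i]rev_ordK; case: (inC (rev_ord i)) => //.
    by rewrite mem_itv /=; clear -ir ilt r0; lia.
  have [o e [c cP cs]] := cst_at_hook r0 card supp ends.
  have {}osc := o.1 (osc x0); have {}conn := e.1 (conn x0).
  exists c; have csV y : (nat_perm s^-1 y != y) = [|| y < r, n - r <= y < n | y == c].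
    rewrite -cs; congr (~~ _); rewrite -(can_eq (nat_permK s)) -{1}[s]invgK nat_permK.
    exact: eq_sym.
  split=> //.
  - exact: nat_permK.
  - by move=> x; rewrite -{1}[s]invgK nat_permK.
  - exact: porbit_conn supp.
  - move=> a; have [ra|ar] := leqP r a; last by case: (conn a ar).
    by apply: (@unique_exit_inner n r a c _ _ ra) => y; rewrite cs.
  - move=> a; have [ra|ar] := leqP r a; last by case: (conn a ar).
    by apply: (@unique_exit_inner n r a c _ _ ra) => y; rewrite csV.
move=> [c hs]; have nP := hooked_n hs; have cP := hooked_c hs.
have ends (i : 'I_n) : (i < r) || (n - r <= i) -> s i != i.
  move=> ir; rewrite -val_eqE /= -nat_permE (hooked_supp hs).
  by have := ltn_ord i; clear -ir; lia.
have atx x : oscillating_cycle (cst_at s x) /\ connected_intervals_cycle (cst_at s x).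
  have [sx|sx] := eqVneq (s x) x.
    apply: trivial_cycle_hook; rewrite size_orbit_porbit.
    by apply/eqP; rewrite -porbit_fixed sx.
  rewrite -(same x sx) in card; have suppx y : (s y != y) = (y \in porbit s x).
    by rewrite (same x sx) supp.
  have [o e _] := cst_at_hook r0 card suppx ends; split.
    by apply/o.2; apply: (hooked_osc hs).
  by apply/e.2 => a _; split; [apply: (hooked_exit hs) | apply: (hooked_entry hs)].
split; [by move=> x; case: (atx x) | by move=> x; case: (atx x) |].
move=> _; exists (porbit s x0); split=> // [|i]; first exact: imset_f.
rewrite mem_itv kr -!supp => ir; split; apply: ends; rewrite /=.
  by case/andP: ir => _ ->.
by have := ltn_ord i; clear -ir nP; lia.
Qed.

(** * The stair element *)

Lemma next_index (T : eqType) (c : seq T) x0 p : uniq c -> p.+1 < size c ->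
  next c (nth x0 c p) = nth x0 c p.+1.
Proof.
case: c => // y c uc pc; rewrite next_nth mem_nth ?(ltnW pc) //.
by rewrite index_uniq ?(ltnW pc) //; apply: set_nth_default.
Qed.

Lemma next_last (T : eqType) (c : seq T) x0 p : uniq c -> p.+1 = size c ->
  next c (nth x0 c p) = nth x0 c 0.
Proof.
case: c => // y c uc pc; rewrite next_nth mem_nth -?pc //.
by rewrite index_uniq -?pc // nth_default //; case: pc => <-.
Qed.

Lemma prod_cycle_perm_singletons (T : finType) m (t : seq T) :
  (\prod_(c <- reshape (nseq m 1%N) t) cycle_perm c)%g = 1%g.
Proof.
have triv (c : seq T) : size c <= 1 -> cycle_perm c = 1%g.
  case: c => [|x [|//]] _; apply/permP => y; rewrite cycle_permE // [RHS]perm1.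
    by [].
  by rewrite next_nth inE; case: eqP => //= ->; rewrite eqxx.
elim: m t => [|m IH] t; rewrite ?big_nil // big_cons IH mulg1.
by apply: triv; rewrite size_take; case: ltnP.
Qed.

Lemma stair_perm_hook n k :
  stair_perm n (hook n k) = cycle_perm (take k (stair_seq n)).
Proof. by rewrite /stair_perm big_cons prod_cycle_perm_singletons mulg1. Qed.

Lemma val_stair_entry n (p : 'I_n) :
  stair_entry p = (if odd p then n - p./2.+1 else p./2) :> nat.
Proof. by rewrite /stair_entry; case: ifP. Qed.

Lemma stair_entry_inj n : injective (@stair_entry n).
Proof.
move=> p q e; apply/val_inj; have := congr1 val e; rewrite /= !val_stair_entry.
have := ltn_ord p; have := ltn_ord q; have := odd_double_half p; have := odd_double_half q.
by case: (odd p); case: (odd q); clear; lia.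
Qed.

Section Stair.
Variables (n r : nat).
Hypotheses (r0 : 0 < r) (nP : r.*2 < n).

Let c := take r.*2.+1 (stair_seq n).

Lemma size_stair : size c = r.*2.+1.
Proof. by rewrite size_takel // size_map size_enum_ord. Qed.

Lemma uniq_stair : uniq c.
Proof.
by apply: take_uniq; rewrite map_inj_uniq ?enum_uniq //; apply: stair_entry_inj.
Qed.

Lemma nth_stair x0 p : p < r.*2.+1 ->
  nth x0 c p = (if odd p then n - p./2.+1 else p./2) :> nat.
Proof.
move=> pk; have pn : p < n by apply: leq_trans nP.
rewrite nth_take // (nth_map (Ordinal pn)) ?size_enum_ord //.
by rewrite val_stair_entry nth_enum_ord.
Qed.

(** The cycle reads 0, n-1, 1, n-2, ..., r: position 2x holds x and position 2x+1 holds x*. *)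
Lemma stair_perm_nat x : nat_perm (stair_perm n (hook n r.*2.+1)) x =
  if x < r then n.-1 - x else if x == r then 0
  else if n - r <= x < n then n - x else x.
Proof.
have [nx|xn] := leqP n x.
  rewrite nat_perm_out //; clear -nx nP; case: ltnP => [|_]; first lia.
  by case: eqP => [|_]; [lia | rewrite andbF].
rewrite (nat_permE _ (Ordinal xn)) stair_perm_hook cycle_permE ?uniq_stair //.
have pos p : p < r.*2.+1 -> x = (if odd p then n - p./2.+1 else p./2) ->
    Ordinal xn = nth (Ordinal xn) c p.
  by move=> pk xE; apply/val_inj; rewrite /= nth_stair.
have [xr|xr] := ltnP x r.
  have x1 : x.*2 < r.*2.+1 by clear -xr; lia.
  have x2 : x.*2.+1 < r.*2.+1 by clear -xr; lia.
  rewrite (pos x.*2 x1) ?odd_double ?doubleK //.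
  rewrite next_index ?uniq_stair ?size_stair //.
  by rewrite nth_stair //= odd_double /= uphalf_double; clear -xn; lia.
have [xE|xE] := eqVneq x r.
  have x1 : r.*2 < r.*2.+1 by [].
  rewrite (pos r.*2 x1) ?odd_double ?doubleK //.
  by rewrite next_last ?uniq_stair ?size_stair // nth_stair.
case: ifP => xl.
  have x1 : (n.-1 - x).*2.+1 < r.*2.+1 by clear -xl nP xn; lia.
  have x2 : (n.-1 - x).*2.+2 < r.*2.+1 by clear -xl nP xn; lia.
  rewrite (pos (n.-1 - x).*2.+1 x1); last first.
    by rewrite /= odd_double /= uphalf_double; clear -xl nP xn; lia.
  rewrite next_index ?uniq_stair ?size_stair //.
  by rewrite nth_stair //= negbK odd_double /= doubleK; clear -xl nP xn; lia.
rewrite next_nth; case: ifP => // /(nthP (Ordinal xn))[p].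
rewrite size_stair => pk /(congr1 val); rewrite /= nth_stair //.
have := odd_double_half p; case: (odd p); clear -pk xl xE xr xn nP; lia.
Qed.

(** For 0 < a <= r the arc on the window of level a runs from a to r, so [f] leaves it at r and its
    inverse at a. *)
Lemma hooked_stair : hooked_perm r r (stair_perm n (hook n r.*2.+1)).
Proof.
set s := stair_perm n _; have fE x := stair_perm_nat x; rewrite -/s in fE.
have fK := nat_permK s.
have gK : cancel (nat_perm s^-1) (nat_perm s).
  by move=> x; rewrite -{1}[s]invgK nat_permK.
have f1 x : x < r -> nat_perm s x = n.-1 - x by rewrite fE => ->.
have f2 x : n - r <= x < n -> nat_perm s x = n - x.
  move=> xh; rewrite fE xh; case: ltnP; first by clear -xh nP; lia.
  by case: eqP => //; clear -xh nP; lia.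
have f3 : nat_perm s r = 0 by rewrite fE ltnn eqxx.
have f4 x : ~~ [|| x < r, n - r <= x < n | x == r] -> nat_perm s x = x.
  by rewrite fE !negb_or => /and3P[/negPf -> /negPf -> /negPf ->].
have g1 x : n - r <= x < n -> nat_perm s^-1 x = n.-1 - x.
  by move=> xh; rewrite -{1}(_ : nat_perm s (n.-1 - x) = x) ?fK // f1; clear -xh; lia.
have g2 x : 0 < x <= r -> nat_perm s^-1 x = n - x.
  by move=> xh; rewrite -{1}(_ : nat_perm s (n - x) = x) ?fK // f2; clear -xh nP; lia.
have g3 : nat_perm s^-1 0 = r by rewrite -f3 fK.
have g4 x : ~~ [|| x < r, n - r <= x < n | x == r] -> nat_perm s^-1 x = x.
  by move=> xo; rewrite -{1}(f4 _ xo) fK.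
have supp x : (nat_perm s x != x) = [|| x < r, n - r <= x < n | x == r].
  have [xr|xr] := ltnP x r; first by rewrite f1 //; clear -xr nP; lia.
  have [xh|xh] := boolP (n - r <= x < n); first by rewrite f2 //; clear -xh nP; lia.
  have [->|xc] := eqVneq x r; first by rewrite f3; clear -r0; lia.
  by rewrite f4 ?eqxx // !negb_or -leqNgt xr xh.
split=> //.
- by clear -nP; lia.
- move=> X x y Xx Xy sx sy.
  have [/hasP[z _ /andP[? ?]]|] :=
    boolP (has (fun z => X z && ~~ X (nat_perm s z)) (iota 0 n)); first by exists z.
  rewrite -all_predC => /allP closed.
  have {closed} closed z : z < n -> X z -> X (nat_perm s z).
    by move=> zn Xz; have := closed z; rewrite mem_iota add0n zn /= Xz negbK; apply.
  (* A closed set containing a small i contains i*, then i+1, and so on up to r; from there it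
     contains 0 and all moved labels. *)
  have low i : i < r -> X i -> X (n.-1 - i) /\ X i.+1.
    move=> ir Xi; have X1 : X (n.-1 - i).
      by rewrite -f1 //; apply: closed => //; clear -ir nP; lia.
    split=> //; have -> : i.+1 = nat_perm s (n.-1 - i).
      by rewrite f2; clear -ir nP; lia.
    by apply: closed => //; clear -ir nP; lia.
  have up d i : i + d <= r -> X i -> X (i + d).
    elim: d i => [|d IH] i id Xi; first by rewrite addn0.
    rewrite addnS; apply: (low _ _ _).2; first by clear -id; lia.
    by apply: IH => //; clear -id; lia.
  have Xr : X r.
    move: sx; rewrite supp => /or3P[xr|xh|/eqP <- //].
      by rewrite -(subnKC (ltnW xr)); apply: up => //; rewrite subnKC // ltnW.
    have Xn : X (n - x) by rewrite -f2 //; apply: closed => //; case/andP: xh.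
    have nr : n - x <= r by clear -xh; lia.
    by rewrite -(subnKC nr); apply: up => //; rewrite subnKC.
  have X0 : X 0 by rewrite -f3; apply: closed => //; clear -nP; lia.
  have Xlow i : i <= r -> X i by move=> ir; apply: (up i 0).
  case/negP: Xy; move: sy; rewrite supp => /or3P[yr|yh|/eqP -> //].
    by apply/Xlow/ltnW.
  have -> : y = n.-1 - (n.-1 - y) by clear -yh; lia.
  by apply: (low _ _ _).1; [|apply: Xlow]; clear -yh; lia.
- left; split=> x xr; first by rewrite f1 //; clear -xr nP; lia.
  by rewrite g1 //; clear -xr nP; lia.
- move=> a; suff E x : window n a x -> ~~ window n a (nat_perm s x) -> x = r.
    by move=> x y wx wy sx sy; rewrite (E x) // (E y).
  move=> wx; apply: contraNeq => xr.
  have [xl|xl] := ltnP x r.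
    by rewrite f1 //; move: wx; rewrite /window; clear -xl nP; lia.
  have [xh|xh] := boolP (n - r <= x < n).
    by rewrite f2 //; move: wx; rewrite /window; clear -xh nP; lia.
  by rewrite f4 // !negb_or -leqNgt xl xh.
move=> a; suff E x : window n a x -> ~~ window n a (nat_perm s^-1 x) -> x = a.
  by move=> x y wx wy sx sy; rewrite (E x) // (E y).
move=> wx; apply: contraNeq => xa.
have [xh|xh] := boolP (n - r <= x < n).
  by rewrite g1 //; move: wx; rewrite /window; clear -xh nP; lia.
have [xl|xl] := leqP x r; last first.
  by rewrite g4 // !negb_or -leqNgt (ltnW xl) xh neq_ltn xl orbT.
have [x0|x0] := posnP x.
  by rewrite x0 g3; move: wx xa; rewrite x0 /window; clear -nP; lia.
by rewrite g2 ?x0 //; move: wx xa; rewrite /window; clear -xl nP; lia.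
Qed.

End Stair.

Theorem theorem4p40 (n k : nat) (s : 'S_n) :
  0 < n -> 0 < k <= n -> odd k ->
  has_cycle_type s (hook n k) ->
  s \in stair_class n (hook n k) <-> hook_properties k s.
Proof.
move=> _ /andP[k0 kn] ok ct.
have [r kE] : exists r, k = r.*2.+1 by exists k./2; rewrite -[LHS]odd_double_half ok.
subst k; rewrite inE; case: (posnP r) => [re|r0].
  (* For k = 1 the cycle type forces [s] to be the identity, which is also the stair element. *)
  subst r; have s1 x : #|porbit s x| = 1.
    have : #|porbit s x| \in [seq #|C| | C : {set 'I_n} <- enum (porbits s)].
      by apply: map_f; rewrite mem_enum; apply: imset_f.
    by rewrite (perm_mem ct) inE mem_nseq => /orP[|/andP[_]] /eqP.
  have -> : s = 1%g.
    by apply/permP => x; rewrite perm1; apply/eqP; rewrite porbit_fixed s1.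
  have st : stair_perm n (hook n 1) = 1%g.
    by rewrite /stair_perm (_ : hook n 1 = nseq (n - 1).+1 1) ?prod_cycle_perm_singletons.
  rewrite st conj_equiv_refl; split=> // _.
  have triv x : oscillating_cycle (cst_at (1 : 'S_n)%g x) /\
      connected_intervals_cycle (cst_at (1 : 'S_n)%g x).
    apply: trivial_cycle_hook; rewrite size_orbit_porbit.
    by apply/eqP; rewrite -porbit_fixed perm1.
  by split=> // x; case: (triv x).
rewrite (hook_propertiesP r0 ct); have hst := hooked_stair r0 kn; split.
  by move=> e; apply: hooked_perm_equiv e hst.
by case=> c; apply: conj_equiv_hooked hst.
Qed.
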